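(* Let $p>1$, $\alpha\in(0,2)$ and $\gamma\in\mathbb{R}$. Suppose that for all $A>0$ and $d\ge 0$ there is a constant $C=C(A,d)<\infty$ (which may also depend on $p,\alpha,\gamma$) such that for every nonnegative compactly supported Borel measure $\mu$ on $\mathbb{R}^2$ whose support has diameter $d$ and which satisfies $$\mu\big(B(y,r)\big)\le A\,r^{\alpha}\qquad\text{for all } y\in\mathbb{R}^2\text{ and } r>0,$$ one has $$\int_0^\infty |\widehat{\mu}(t,t^p)|^2\,t^{\gamma}\,dt\le C.$$ Then: (i) if $1<\alpha<2$, then $-1<\gamma\le \alpha p-\alpha/2-p$; (ii) if $1/2<\alpha\le 1$, then $-1<\gamma\le -1/2$; (iii) if $0<\alpha\le 1/2$, then $-1<\gamma\le \alpha-1$.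
   Context: $B(y,r)$ denotes the ball in $\mathbb{R}^2$ with center $y$ and radius $r$. The Fourier transform of a finite Borel measure $\mu$ on $\mathbb{R}^2$ is $\widehat{\mu}(\xi)=\int e^{-2\pi i \xi\cdot x}\,d\mu(x)$. *)

(* Defs.v *)
From HB Require Import structures.
From mathcomp Require Import all_boot all_order all_algebra.
From mathcomp Require Import all_classical all_reals all_analysis.
From mathcomp.real_closed Require Import complex.

Set Implicit Arguments.
Unset Strict Implicit.
Unset Printing Implicit Defensive.

Import Order.TTheory GRing.Theory Num.Theory.
Import numFieldNormedType.Exports.

Local Open Scope classical_set_scope.
Local Open Scope ring_scope.
Local Open Scope complex_scope.

(* The plane is the product type [R * R]. Its canonical sigma-algebra is the
   product of the Borel sigma-algebras, that is the Borel sigma-algebra of the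
   plane, and its topology is the usual one. However, the canonical norm (and
   hence [ball]) of the product is the sup norm, so the Euclidean notions are
   defined separately. *)
Section Plane.
Context {R : realType}.
Implicit Types (x y : R * R) (S : set (R * R)).

Definition dotp x y : R := x.1 * y.1 + x.2 * y.2.

Definition enorm x : R := Num.sqrt (dotp x x).

Definition eball y (r : R) : set (R * R) := [set x | enorm (x - y) < r].

(* Meaningful for bounded [S]; the diameter of the empty set is 0. *)
Definition ediam S : R := sup [set enorm (z.1 - z.2) | z in S `*` S].

End Plane.

Section Measures.
Context {R : realType}.
Implicit Types mu : {measure set (R * R) -> \bar R}.

Definition msupport mu : set (R * R) :=
  [set x | forall U, open_nbhs x U -> (0 < mu U)%E].

(* [expi x] is the complex exponential e^(ix). *)
Definition expi (x : R) : R[i] := cos x +i* sin x.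

Definition cintegral mu (f : R * R -> R[i]) : R[i] :=
  (\int[mu]_x complex.Re (f x)) +i* (\int[mu]_x complex.Im (f x)).

Definition fourier mu (xi : R * R) : R[i] :=
  cintegral mu (fun x => expi (- (2 * pi * dotp xi x))).

Definition cmod (z : R[i]) : R := ComplexField.Normc.normc z.

End Measures.

(* Main.v *)
Require Import Defs.
From HB Require Import structures.
From mathcomp Require Import all_boot all_order all_algebra.
From mathcomp Require Import all_classical all_reals all_analysis.
From mathcomp.real_closed Require Import complex.
From mathcomp Require Import measurable_realfun ring lra.

(* Test measures: Lebesgue measure on a fixed box, plus [h] times Lebesgue
   measure on a union of pieces of [n] parallel thin strips, lying one above
   another at distance [1 / n].
   - The box fixes the support, hence the diameter, of all of them.
   - Within a strip, the set where the phase at a base point of the curve lies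
     in a well chosen quadrant has at least a quarter of the measure of the
     strip. On that set there is no cancellation in the Fourier integral, as long
     as the phase differs from the one at the base point by almost a constant.
   - Summing the squared Fourier transforms over all subfamilies of the pieces
     removes the interferences, so that the hypothesis bounds [n] times the
     energy of one piece.
   For [alpha >= 1] the strips are orthogonal to the tangent at [(T, T ^ p)], of
   size [1] x [L ^ (-1)] with [L = T ^ (p - 1/2)], and [n ~ L ^ (alpha - 1)]; the
   phase is almost constant up to an additive constant for [t - T << T ^ (1/2)].
   For measures on the box, the ball condition with exponent [1] implies the one
   with any smaller exponent, so the case [alpha = 1] also serves [alpha < 1]. For
   [alpha <= 1/2] the strips are replaced by rectangles of size
   [T ^ (-1)] x [T ^ (-p)], with [n ~ T ^ alpha]; the phase is almost constant up
   to an additive constant for [t << T]. Letting [T] tend to infinity gives the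
   upper bounds; the lower bound comes from [t -> 0]. *)

Set Implicit Arguments.
Unset Strict Implicit.
Unset Printing Implicit Defensive.

Import Order.TTheory GRing.Theory Num.Theory.
Import numFieldNormedType.Exports.

Local Open Scope classical_set_scope.
Local Open Scope ring_scope.

(** * Elementary estimates *)

Fixpoint sublists (T : Type) (s : seq T) : seq (seq T) :=
  if s is x :: s' then sublists s' ++ map (cons x) (sublists s') else [:: [::]].

Lemma size_sublists (T : Type) (s : seq T) : size (sublists s) = (2 ^ size s)%N.
Proof.
by elim: s => //= x s ih; rewrite size_cat size_map ih expnS mul2n -addnn.
Qed.

Lemma sublists_subseq (T : eqType) (s r : seq T) : r \in sublists s -> subseq r s.
Proof.
elim: s r => [|x s ih] r /=; first by rewrite inE.
rewrite mem_cat => /orP[/ih rs|/mapP[r' /ih r's ->]].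
  exact: subseq_trans rs (subseq_cons s x).
by rewrite /= eqxx.
Qed.

(* The average of the right-hand summand over [r] is
   [(g + (\sum_(j <- s) z j) / 2) ^+ 2 + (\sum_(j <- s) z j ^+ 2) / 4]. *)
Lemma sum_sublists_sqr (R : realFieldType) (T : Type) (g : R) (z : T -> R)
    (s : seq T) :
  2 ^+ size s / 4 * \sum_(j <- s) z j ^+ 2 <=
  \sum_(r <- sublists s) (g + \sum_(j <- r) z j) ^+ 2.
Proof.
elim: s g => [|x s ih] g /=.
  by rewrite !big_seq1 !big_nil mulr0 addr0 sqr_ge0.
rewrite big_cat big_map /= big_cons -big_split /=.
(* Pair each sublist without [x] with its extension by [x]: [a ^+ 2 + (a + z) ^+ 2 = 2 * (a + z / 2)
   ^+ 2 + z ^+ 2 / 2]. The induction hypothesis then applies with [g + z x / 2]. *)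
rewrite (_ : \sum_(i <- sublists s) _ = 2 * \sum_(r <- sublists s)
    (g + z x / 2 + \sum_(j <- r) z j) ^+ 2 + 2 ^+ size s / 2 * z x ^+ 2).
  have := ih (g + z x / 2); rewrite exprS; set S1 := \sum_(j <- s) _.
  by set S2 := \sum_(j <- _) _; set N := 2 ^+ _; nra.
transitivity (\sum_(r <- sublists s)
    (2 * (g + z x / 2 + \sum_(j <- r) z j) ^+ 2 + z x ^+ 2 / 2)).
  by apply: eq_bigr => r _; rewrite big_cons; field.
rewrite big_split /= mulr_sumr; congr (_ + _).
rewrite big_const_seq count_predT size_sublists iter_addr_0.
rewrite -(mulr_natr _ (2 ^ size s)) natrX.
by field.
Qed.

(** Mean value theorem on [[0, d]]: both derivatives are at most 1 in absolute value. *)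
Lemma small_angle (R : realType) (d : R) : `|d| <= 1 / 4 ->
  `|sin d| <= 1 / 4 /\ 3 / 4 <= cos d.
Proof.
wlog d0 : d / 0 <= d.
  move=> H dle; have [d0|d0] := leP 0 d; first exact: H.
  have := H (- d); rewrite oppr_ge0 normrN sinN cosN normrN; apply => //.
  exact: ltW.
rewrite ger0_norm// => dle.
have csin : {within `[0, d], continuous (@sin R)}.
  by apply: continuous_subspaceT => x; exact: continuous_sin.
have ccos : {within `[0, d], continuous (@cos R)}.
  by apply: continuous_subspaceT => x; exact: continuous_cos.
have [c _] := MVT_segment d0 (fun x _ => is_derive_sin x) csin.
rewrite sin0 !subr0 => ->.
have [c' _] := MVT_segment d0 (fun x _ => is_derive_cos x) ccos.
rewrite cos0 subr0 => h.
have cN1 := cos_geN1 c; have c1 := cos_le1 c; have s1 := sin_le1 c'.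
by split; [rewrite ler_norml; apply/andP; split; nra|nra].
Qed.

(** The expression equals [cos d * (u + v) + sin d * w] with [u = |cos t|] and [v = |sin t|]. Here
    [u + v >= 1], and [w ^+ 2 = 1 - 2 * u * v] gives [|w| <= 1], so the value is at least
    [3 / 4 - 1 / 4]. *)
Lemma quadrant_lower (R : realType) (e1 e2 t d : R) :
  e1 ^+ 2 = 1 -> e2 ^+ 2 = 1 -> 0 <= e1 * cos t -> 0 <= e2 * sin t ->
  `|d| <= 1 / 4 -> 1 / 2 <= e1 * cos (t + d) + e2 * sin (t + d).
Proof.
move=> e11 e21 c0 s0 /small_angle[]; rewrite ler_norml => /andP[sl su] cl.
have cs := cos2Dsin2 t.
set u := e1 * cos t in c0; set v := e2 * sin t in s0.
have uv : u ^+ 2 + v ^+ 2 = 1 by rewrite !exprMn e11 e21 !mul1r.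
have uv1 : 1 <= u + v by nra.
set w := e2 * cos t - e1 * sin t.
have w2 : w ^+ 2 + 2 * (u * v) = 1.
  transitivity (e2 ^+ 2 * cos t ^+ 2 + e1 ^+ 2 * sin t ^+ 2).
    by rewrite /w /u /v; ring.
  by rewrite e11 e21 !mul1r.
have wl : -1 <= w by nra.
have wu : w <= 1 by nra.
rewrite (_ : e1 * _ + _ = cos d * (u + v) + sin d * w); last first.
  by rewrite cosD sinD /u /v /w; ring.
nra.
Qed.

(** Write the power as [expR y] with [y = p * ln (1 + u)]. Then [y] differs from [p * u] by at most
    [p * u ^+ 2], and [expR y] from [1 + y] by at most [y ^+ 2 * expR p]. *)
Lemma powR_taylor2 (R : realType) (p u : R) : 1 < p -> 0 <= u <= 1 ->
  `|(1 + u) `^ p - 1 - p * u| <= p ^+ 2 * expR p * u ^+ 2.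
Proof.
move=> p1 /andP[u0 u1].
have pos1u : 0 < 1 + u by lra.
rewrite /powR gt_eqF//; set y := p * ln (1 + u).
have lnu : ln (1 + u) <= u by apply: le_ln1Dx; lra.
(* This comes from [ln (1 + x) <= x] at [x = - u / (1 + u)], where [1 + x] is the inverse of
   [1 + u]. *)
have lnl : u - u ^+ 2 <= ln (1 + u).
  have := @le_ln1Dx R (- (u / (1 + u))).
  have -> : 1 + - (u / (1 + u)) = (1 + u)^-1 by field; rewrite gt_eqF.
  rewrite lnV ?posrE// => H.
  have /H : -1 < - (u / (1 + u)).
    by rewrite ltrN2 ltr_pdivrMr//; lra.
  rewrite lerN2; apply: le_trans.
  by rewrite ler_pdivlMr//; nra.
have ln0 : 0 <= ln (1 + u) by rewrite ln_ge0//; lra.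
have y0 : 0 <= y by rewrite mulr_ge0//; lra.
have yu : y <= p * u by rewrite ler_pM2l//; lra.
have yp : y <= p by nra.
have eyp : expR y <= expR p by rewrite ler_expR.
have ey1 : 1 + y <= expR y := expR_ge1Dx y.
have ep0 := expR_gt0 p.
have ep1 : 1 <= expR p by rewrite -expR0 ler_expR; lra.
have eyu : expR y - 1 <= y * expR y.
  have := expR_ge1Dx (- y); rewrite expRN => h.
  have ey0 := expR_gt0 y.
  have : (1 - y) * expR y <= 1 by rewrite -ler_pdivlMr// div1r.
  lra.
have y2 : y ^+ 2 <= p ^+ 2 * u ^+ 2 by rewrite -exprMn ler_pXn2r// nnegrE; lra.
rewrite ler_norml; apply/andP; split.
  have : p * (u - u ^+ 2) <= y by rewrite ler_pM2l//; lra.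
  have : p * u ^+ 2 <= p ^+ 2 * expR p * u ^+ 2.
    rewrite ler_wpM2r ?sqr_ge0// expr2 -mulrA ler_peMr//; first lra.
    by nra.
  lra.
have : expR y - 1 - y <= y ^+ 2 * expR p.
  have : y * (expR y - 1) <= y * (y * expR p).
    by rewrite ler_wpM2l// (le_trans eyu)// ler_wpM2l.
  have : y * (expR y - 1) - (expR y - 1 - y) = y * expR y - (expR y - 1) by ring.
  rewrite expr2 -mulrA; lra.
have : y ^+ 2 * expR p <= p ^+ 2 * expR p * u ^+ 2.
  by rewrite [leRHS]mulrAC ler_pM2r.
lra.
Qed.

(** Converts estimates uniform in [T] into bounds on exponents: for positive [e], the point with
    [T ^ e = C + 1] violates the estimate. *)
Lemma powR_bounded_le0 (R : realType) (e C : R) :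
  (forall T, 1 <= T -> T `^ e <= C) -> e <= 0.
Proof.
move=> H; rewrite leNgt; apply/negP => e0.
have C0 : 0 <= C by apply: le_trans (powR_ge0 1 e) (H _ _).
have := H ((C + 1) `^ e^-1); rewrite -powRrM mulVf ?gt_eqF// powRr1; last lra.
have -> : 1 <= (C + 1) `^ e^-1.
  rewrite [leLHS](_ : 1 = 1 `^ e^-1); last by rewrite powR1.
  by apply: ge0_ler_powR; rewrite ?nnegrE ?invr_ge0 /=; lra.
by move=> /(_ isT); lra.
Qed.

Lemma count_nat_itv (R : realFieldType) (u v : R) (n : nat) : 0 <= v - u + 1 ->
  (count (fun j : nat => u <= j%:R <= v) (iota 0 n))%:R <= v - u + 1.
Proof.
(* The induction also carries the bound [n - u] on the count below [n] once [u <= n]. When [n]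
   itself is counted, [n <= v] turns [n - u + 1] into at most [v - u + 1]. *)
move=> uv; suff [h _] : (count (fun j : nat => u <= j%:R <= v) (iota 0 n))%:R
    <= v - u + 1 /\ (u <= n%:R ->
    (count (fun j : nat => u <= j%:R <= v) (iota 0 n))%:R <= n%:R - u) by [].
elim: n => [|n [ih1 ih2]]; first by split=> /= [|?]; lra.
rewrite -addn1 iotaD count_cat natrD /= add0n addn0 natrD.
pose c : R := (count (fun j : nat => u <= j%:R <= v) (iota 0 n))%:R.
rewrite -/c in ih1 ih2 *.
have c0 : n%:R < u -> c = 0.
  move=> un; rewrite /c (_ : count _ _ = 0%N)//; apply/eqP.
  rewrite -leqn0 leqNgt -has_count; apply/hasPn => j; rewrite mem_iota /= => jn.
  by rewrite negb_and -ltNge (lt_trans _ un)// ltr_nat.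
move: c ih1 ih2 c0 => c ih1 ih2 c0.
have [/andP[un nv]|unv] := boolP (u <= n%:R <= v).
  by have := ih2 un; split; rewrite /=; lra.
split; rewrite /= addr0; first lra.
by move=> un1; have [/ih2|/c0] := leP u n%:R; lra.
Qed.

(** * Absence of cancellation *)

Section finite_integrals.
Context d (T : measurableType d) (R : realType).
Implicit Types (m : {measure set T -> \bar R}) (f : T -> R) (D : set T).

Lemma bounded1_integrable m D f : measurable D -> (m D < +oo)%E ->
  measurable_fun setT f -> (forall x, `|f x| <= 1) -> m.-integrable D (EFin \o f).
Proof.
move=> mD Doo mf f1; apply: measurable_bounded_integrable => //.
  exact: measurable_funTS.
by exists 1; split=> // M M1 x _; rewrite /= (le_trans (f1 x))// ltW.
Qed.

Lemma Rintegral_measure_add m1 m2 f : m1.-integrable setT (EFin \o f) ->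
  m2.-integrable setT (EFin \o f) ->
  \int[measure_add m1 m2]_x f x = \int[m1]_x f x + \int[m2]_x f x.
Proof.
move=> i1 i2; rewrite /Rintegral integral_measure_add//.
by rewrite fineD//; apply: integrable_fin_num.
Qed.

Lemma Rintegral_mscale m (k : {nonneg R}) f : m.-integrable setT (EFin \o f) ->
  \int[mscale k m]_x f x = k%:num * \int[m]_x f x.
Proof.
move=> mf; have mf' := measurable_int _ mf.
have ip := integrable_funepos measurableT mf.
have iN := integrable_funeneg measurableT mf.
rewrite /Rintegral integralE [in RHS]integralE.
rewrite !ge0_integral_mscale//; last 2 first.
- exact: measurable_funeneg.
- exact: measurable_funepos.
have pf := integrable_fin_num measurableT ip.
have nf := integrable_fin_num measurableT iN.
by rewrite fineB ?fin_numM// !fineM// -mulrBr -fineB.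
Qed.

Lemma Rintegral_mrestr m D (mD : measurable D) f : (m D < +oo)%E ->
  measurable_fun setT f -> (forall x, `|f x| <= 1) ->
  \int[mrestr m mD]_x f x = \int[m]_(x in D) f x.
Proof.
move=> Doo mf f1; rewrite /Rintegral; congr fine.
have mrT : (mrestr m mD setT < +oo)%E by rewrite /mrestr setTI.
rewrite (@negligible_integral _ _ _ _ setT (~` D))//; last 3 first.
- exact: measurableC.
- exact: bounded1_integrable.
- by change (m (~` D `&` D) = 0%E); rewrite setICl measure0.
rewrite setTD setCK; apply: eq_measure_integral => A mA AD.
by change (m (A `&` D) = m A); rewrite setIidl.
Qed.

End finite_integrals.

Section quadrants.
Context d (T : measurableType d) (R : realType).
Variables (m : {measure set T -> \bar R}) (P : set T) (t0 : T -> R).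
Hypotheses (mP : measurable P) (Poo : (m P < +oo)%E).
Hypothesis mt0 : measurable_fun setT t0.

Let quadrant (e1 e2 : R) : set T :=
  P `&` [set x | 0 <= e1 * cos (t0 x)] `&` [set x | 0 <= e2 * sin (t0 x)].

Let measurable_cosT : measurable_fun setT (fun x => cos (t0 x)).
Proof.
apply: (measurableT_comp _ mt0).
apply: continuous_measurable_fun; exact: continuous_cos.
Qed.

Let measurable_sinT : measurable_fun setT (fun x => sin (t0 x)).
Proof.
apply: (measurableT_comp _ mt0).
apply: continuous_measurable_fun; exact: continuous_sin.
Qed.

Let measurable_nonneg (e : R) (f : T -> R) : measurable_fun setT f ->
  measurable [set x | 0 <= e * f x].
Proof.
move=> mf; have mef : measurable_fun setT (fun x => e * f x).
  by apply: measurable_funM.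
have := mef measurableT `[0, +oo[%classic (measurable_itv _).
rewrite setTI; congr measurable; apply/seteqP; split=> x /=;
  by rewrite in_itv /= andbT.
Qed.

Let measurable_quadrant e1 e2 : measurable (quadrant e1 e2).
Proof.
by apply: measurableI; [apply: measurableI => //|]; apply: measurable_nonneg.
Qed.

(** The four quadrants cover [P], so by subadditivity they cannot all have less than a quarter of
    its measure. *)
Let large_quadrant : exists e1 e2, [/\ e1 ^+ 2 = 1, e2 ^+ 2 = 1 &
  fine (m P) / 4 <= fine (m (quadrant e1 e2))].
Proof.
have fq e1 e2 : m (quadrant e1 e2) \is a fin_num.
  rewrite ge0_fin_numE// (le_lt_trans _ Poo)// le_measure ?inE//.
  by move=> x [[]].
have cover : P `<=` (quadrant 1 1 `|` quadrant 1 (-1)) `|`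
                    (quadrant (-1) 1 `|` quadrant (-1) (-1)).
  move=> x Px; rewrite /quadrant /= !mul1r !mulN1r !oppr_ge0.
  by have := isT; have [?|/ltW ?] := leP 0 (cos (t0 x));
    have [?|/ltW ?] := leP 0 (sin (t0 x));
    tauto.
have le4 : fine (m P) <= fine (m (quadrant 1 1)) + fine (m (quadrant 1 (-1))) +
    (fine (m (quadrant (-1) 1)) + fine (m (quadrant (-1) (-1)))).
  rewrite -lee_fin !EFinD !fineK ?fq ?ge0_fin_numE//.
  apply: le_trans (le_measure _ _ _ cover) _; rewrite ?inE//.
    by do ![apply: measurableU => //].
  have U2 X Y : measurable X -> measurable Y -> (m (X `|` Y) <= m X + m Y)%E.
    by move=> mX mY; exact: measureU2.
  apply: (le_trans (U2 _ _ _ _)); try exact: measurableU.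
  by rewrite leeD// U2.
have N1 : (-1) ^+ 2 = 1 :> R by rewrite sqrrN expr1n.
have P1 : 1 ^+ 2 = 1 :> R by rewrite expr1n.
have [h|h1] := leP (fine (m P) / 4) (fine (m (quadrant 1 1))).
  by exists 1, 1.
have [h|h2] := leP (fine (m P) / 4) (fine (m (quadrant 1 (-1)))).
  by exists 1, (-1).
have [h|h3] := leP (fine (m P) / 4) (fine (m (quadrant (-1) 1))).
  by exists (-1), 1.
by exists (-1), (-1); split=> //; lra.
Qed.

(* [E] is the part of [P] where [t0] lies in the quadrant that gets the largest
   measure. *)
Lemma exists_no_cancellation : exists E, [/\ measurable E, E `<=` P &
  forall (t : T -> R) (k : R), measurable_fun setT t ->
    (forall x, P x -> `|t x - t0 x - k| <= 1 / 4) ->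
    fine (m P) ^+ 2 / 128 <=
    (\int[m]_(x in E) cos (t x)) ^+ 2 + (\int[m]_(x in E) sin (t x)) ^+ 2].
Proof.
have [e1 [e2 [e11 e21 Ple]]] := large_quadrant.
exists (quadrant e1 e2); split=> //; first by move=> x [[]].
move=> t k mt tk.
set E := quadrant e1 e2 in Ple *.
have mE : measurable E by exact: measurable_quadrant.
have Eoo : (m E < +oo)%E.
  by rewrite (le_lt_trans _ Poo)// le_measure ?inE// => x [[]].
have icos : m.-integrable E (EFin \o (fun x => cos (t x))).
  apply: bounded1_integrable => // [|x]; last first.
    by rewrite ler_norml cos_geN1 cos_le1.
  apply: (measurableT_comp _ mt).
  apply: continuous_measurable_fun; exact: continuous_cos.
have isin : m.-integrable E (EFin \o (fun x => sin (t x))).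
  apply: bounded1_integrable => // [|x]; last by rewrite sin_max.
  apply: (measurableT_comp _ mt).
  apply: continuous_measurable_fun; exact: continuous_sin.
(* [A * cos t + B * sin t = e1 * cos (t - k) + e2 * sin (t - k)]: the shift by the constant [k] only
   rotates the vector [(e1, e2)]. *)
set A := e1 * cos k - e2 * sin k; set B := e1 * sin k + e2 * cos k.
have AB : A ^+ 2 + B ^+ 2 = 2.
  transitivity ((e1 ^+ 2 + e2 ^+ 2) * (cos k ^+ 2 + sin k ^+ 2)).
    by rewrite /A /B; ring.
  by rewrite e11 e21 cos2Dsin2 mulr1.
have iA : m.-integrable E (EFin \o (fun x => A * cos (t x))).
  by apply: eq_integrable (integrableZl mE A icos).
have iB : m.-integrable E (EFin \o (fun x => B * sin (t x))).
  by apply: eq_integrable (integrableZl mE B isin).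
have : fine (m E) / 2 <= \int[m]_(x in E) (A * cos (t x) + B * sin (t x)).
  rewrite mulrC -Rintegral_cst//; apply: le_Rintegral => //.
  - apply: measurable_bounded_integrable => //.
    exists 1; split=> // M M1 x _ /=.
    by rewrite ger0_norm; lra.
  - by apply: eq_integrable (integrableD mE iA iB).
  - move=> x [[Px c0] s0].
    have := quadrant_lower e11 e21 c0 s0 (tk x Px).
    rewrite (_ : t0 x + _ = t x - k); last by ring.
    by rewrite cosB sinB /A /B; lra.
rewrite RintegralD// !RintegralZl//.
set c := Rintegral _ _ _; set s := Rintegral _ _ _ => ABcs.
have mE0 : 0 <= fine (m E) by rewrite fine_ge0.
have mP0 : 0 <= fine (m P) by rewrite fine_ge0.
have : (fine (m E) / 2) ^+ 2 <= (A * c + B * s) ^+ 2.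
  by rewrite ler_pXn2r// nnegrE; lra.
(* Lagrange's identity gives Cauchy-Schwarz. The constant 128 is [2 * (2 * 4) ^+ 2]: the first 2 is
   [A ^+ 2 + B ^+ 2], the second comes from the pointwise bound [1 / 2], and 4 from the number of
   quadrants. *)
have : (A * c + B * s) ^+ 2 + (A * s - B * c) ^+ 2 = 2 * (c ^+ 2 + s ^+ 2).
  by rewrite -AB; ring.
have := sqr_ge0 (A * s - B * c).
have : (fine (m P) / 4) ^+ 2 <= fine (m E) ^+ 2.
  by rewrite ler_pXn2r// nnegrE; lra.
rewrite !exprMn; lra.
Qed.

End quadrants.

(** * Lebesgue measure of strips *)

Section planar_lebesgue.
Context {R : realType}.

(* [lebesgue_measure] lives on [measurableTypeR R], whose display is not the
   default one of [R] used by the canonical structure on [R * R]. *)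
Definition leb1 : set R -> \bar R := @lebesgue_measure R.

HB.instance Definition _ := @isMeasure.Build _ R R leb1
  (measure0 (@lebesgue_measure R)) (measure_ge0 (@lebesgue_measure R))
  (@measure_semi_sigma_additive _ _ _ (@lebesgue_measure R)).

HB.instance Definition _ := @Measure_isSigmaFinite.Build _ R R leb1
  (sigma_finiteT (@lebesgue_measure R)).

Definition leb2 : set (R * R)%type -> \bar R := (leb1 \x leb1)%E.

Let leb1x1 : {measure set (R * R)%type -> \bar R} := (leb1 \x leb1)%E.

HB.instance Definition _ := @isMeasure.Build _ (R * R)%type R leb2
  (measure0 leb1x1) (measure_ge0 leb1x1)
  (@measure_semi_sigma_additive _ _ _ leb1x1).

Lemma leb2X (A B : set R) : measurable A -> measurable B ->
  leb2 (A `*` B) = (leb1 A * leb1 B)%E.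
Proof. by move=> mA mB; rewrite /leb2 product_measure1E. Qed.

Lemma leb2_sigma_finite : sigma_finite setT leb2.
Proof.
have /sigma_finiteP[F [TF ndF Foo]] := sigma_finiteT (@leb1).
exists (fun n => F n `*` F n).
  rewrite -setXTT TF predeqE => -[x y]; split.
    move=> [/= [n _ Fnx] [k _ Fky]]; exists (maxn n k) => //; split.
    - by move: x Fnx; exact/subsetPset/ndF/leq_maxl.
    - by move: y Fky; exact/subsetPset/ndF/leq_maxr.
  by move=> [n _ []/= ? ?]; split; exists n.
move=> k; have [? ?] := Foo k; split; first exact: measurableX.
by rewrite leb2X// lte_mul_pinfty// ge0_fin_numE.
Qed.

HB.instance Definition _ := @Measure_isSigmaFinite.Build _ (R * R)%type R leb2
  leb2_sigma_finite.

Lemma leb1_itvcc (a b : R) : a <= b -> leb1 `[a, b]%classic = (b - a)%:E.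
Proof.
move=> ab; rewrite /leb1 lebesgue_measure_itv /= lte_fin lt_neqAle ab andbT.
by case: eqP => //= ->; rewrite subrr.
Qed.

(** A parallelogram of slope [a]. Its height is measured vertically, so its area is [W * H] for
    every slope. *)
Definition strip (W H a b : R) : set (R * R)%type :=
  [set x | 0 <= x.1 <= W /\ 0 <= x.2 - a * x.1 - b <= H].

Definition square (y : R * R) (r : R) : set (R * R)%type :=
  `[y.1 - r, y.1 + r]%classic `*` `[y.2 - r, y.2 + r]%classic.

Lemma measurable_le_fun (f : R * R -> R) (a b : R) : measurable_fun setT f ->
  measurable [set x | a <= f x <= b].
Proof.
move=> mf; have := mf measurableT `[a, b]%classic (measurable_itv _).
by rewrite setTI; congr measurable; apply/seteqP; split=> x /=; rewrite in_itv.
Qed.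

Lemma measurable_strip W H a b : measurable (strip W H a b).
Proof.
apply: measurableI; apply: measurable_le_fun; first exact: measurable_fst.
apply: measurable_funB => //.
apply: measurable_funB; first exact: measurable_snd.
by apply: measurable_funM => //; exact: measurable_fst.
Qed.

Lemma measurable_square y r : measurable (square y r).
Proof. exact: measurableX. Qed.

Lemma eballE (y : R * R) (r : R) : 0 < r ->
  eball y r = [set x | (x.1 - y.1) ^+ 2 + (x.2 - y.2) ^+ 2 < r ^+ 2].
Proof.
move=> r0; have E z : (Num.sqrt z < r) = (z < r ^+ 2).
  by rewrite -[in LHS](ger0_norm (ltW r0)) -sqrtr_sqr ltr_sqrt// exprn_gt0.
by apply/seteqP; split=> x; rewrite /eball /enorm /dotp /= E -!expr2.
Qed.

Lemma measurable_eball (y : R * R) (r : R) : 0 < r -> measurable (eball y r).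
Proof.
move=> r0; rewrite eballE//.
set f := fun x : R * R => (x.1 - y.1) ^+ 2 + (x.2 - y.2) ^+ 2.
have mf : measurable_fun setT f.
  apply: measurable_funD;
    apply: measurable_funX;
    exact: measurable_funB.
have := mf measurableT `]-oo, r ^+ 2[%classic (measurable_itv _).
by rewrite setTI; congr measurable; apply/seteqP; split=> x /=; rewrite in_itv.
Qed.

Lemma eball_square (y : R * R) (r : R) : 0 < r -> eball y r `<=` square y r.
Proof.
move=> r0 x; rewrite eballE//= => xy.
have h a b : a ^+ 2 + b ^+ 2 < r ^+ 2 -> - r <= a <= r.
  move=> ab; rewrite -ler_norml -(@ler_pXn2r _ 2)// ?nnegrE ?ltW//.
  by rewrite real_normK ?num_real//; have := sqr_ge0 b; lra.
have := h _ _ xy; rewrite addrC in xy; have := h _ _ xy.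
by rewrite /square /= !in_itv /=; lra.
Qed.

Lemma xsection_strip W H a b x : 0 <= x <= W ->
  xsection (strip W H a b) x = `[a * x + b, a * x + b + H]%classic.
Proof.
move=> xW; apply/seteqP; split=> z; rewrite /xsection /strip /= in_itv inE /=;
  lra.
Qed.

Lemma xsection_stripN W H a b x : ~~ (0 <= x <= W) ->
  xsection (strip W H a b) x = set0.
Proof.
by move=> /negP xW; apply/seteqP; split=> z //; rewrite /xsection /= inE => -[].
Qed.

Lemma leb2_strip W H a b : 0 <= W -> 0 <= H -> leb2 (strip W H a b) = (W * H)%:E.
Proof.
move=> W0 H0; rewrite /leb2 /product_measure1.
rewrite (eq_integral (fun x => H%:E * (\1_(`[0, W]%classic) x)%:E)%E); last first.
  move=> x _ /=; rewrite indicE.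
  have [xW|xW] := boolP (0 <= x <= W).
    rewrite xsection_strip// leb1_itvcc; last lra.
    by rewrite mem_set /= ?in_itv//= mule1; congr EFin; ring.
  rewrite xsection_stripN// measure0 memNset /= ?mule0//.
  by rewrite in_itv /=; exact/negP.
rewrite ge0_integralZl//.
  by rewrite integral_indic// setIT /= leb1_itvcc// subr0 -EFinM mulrC.
by apply/measurable_EFinP; exact: measurable_indic.
Qed.

Lemma leb1_le_itv (A : set R) (a b : R) : a <= b -> measurable A ->
  A `<=` `[a, b]%classic -> (leb1 A <= (b - a)%:E)%E.
Proof. by move=> ab mA Aab; rewrite -leb1_itvcc// le_measure ?inE. Qed.

(* A vertical segment of length [2 * r] meets at most [2 * r * n + 2] strips. *)
Lemma sum_leb2_strips (W H a r : R) (y : R * R) (n : nat) :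
  0 <= W -> 0 <= H -> 0 < r -> (0 < n)%N -> n%:R * H <= 1 ->
  (\sum_(j <- iota 0 n) leb2 (square y r `&` strip W H a (j%:R / n%:R)) <=
   (Num.min (2 * r) W * ((2 * r * n%:R + 2) * Num.min H (2 * r)))%:E)%E.
Proof.
move=> W0 H0 r0 n0 nH.
have n0' : 0 < n%:R :> R by rewrite ltr0n.
set M := Num.min H (2 * r); have M0 : 0 <= M by rewrite le_min H0; lra.
set K := (2 * r * n%:R + 2) * M.
have K0 : 0 <= K by rewrite mulr_ge0// addr_ge0// !mulr_ge0// ltW.
pose J := `[y.1 - r, y.1 + r]%classic `&` `[0, W]%classic.
have mJ : measurable J by exact: measurableI.
have mS j : measurable (square y r `&` strip W H a j).
  by apply: measurableI; [exact: measurable_square|exact: measurable_strip].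
pose slice j x := leb1 (xsection (square y r `&` strip W H a (j%:R / n%:R)) x).
have slice_le x : (\sum_(j <- iota 0 n) slice j x <= (K * \1_J x)%:E)%E.
  have [Jx|Jx] := boolP (x \in J); last first.
    rewrite big1_seq ?indicE ?(negbTE Jx) ?mulr0// => j _.
    rewrite /slice (_ : xsection _ x = set0) ?measure0//.
    apply/seteqP; split=> z //; rewrite /xsection /= inE => -[[/= x1 _] [/= x2 _]].
    by move/negP: Jx; apply; rewrite inE; split => //=; rewrite in_itv.
  rewrite indicE Jx mulr1.
  move: Jx; rewrite inE => -[/= xy xW]; rewrite in_itv /= in xW.
  (* At abscissa [x], strip [j] meets the square only if [u <= j <= v]. Since
     [v - u = 2 * r * n + n * H] and [n * H <= 1], at most [2 * r * n + 2] indices qualify. *)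
  set u := n%:R * (y.2 - r - H - a * x); set v := n%:R * (y.2 + r - a * x).
  have vu : v - u = 2 * r * n%:R + n%:R * H by rewrite /v /u; ring.
  have rn : 0 <= 2 * r * n%:R by rewrite !mulr_ge0// ltW.
  have nH0 : 0 <= n%:R * H by rewrite mulr_ge0// ltW.
  have slice1 j : (slice j x <= (M * (u <= j%:R <= v)%R%:R)%R%:E)%E.
    rewrite /slice (_ : xsection _ x = `[y.2 - r, y.2 + r]%classic `&`
        `[a * x + j%:R / n%:R, a * x + j%:R / n%:R + H]%classic); last first.
      rewrite xsectionI xsection_strip//; congr (_ `&` _).
      by rewrite in_xsectionX// inE.
    have [juv|juv] := boolP (u <= j%:R <= v).
      rewrite mulr1 /M; have [_|_] := ltP H (2 * r).
        rewrite (_ : H = a * x + j%:R / n%:R + H - (a * x + j%:R / n%:R)); last ring.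
        apply: leb1_le_itv; [lra|exact: measurableI|].
        by move=> z [_] /=; rewrite !in_itv /=; lra.
      rewrite (_ : 2 * r = y.2 + r - (y.2 - r)); last ring.
      apply: leb1_le_itv; [lra|exact: measurableI|by move=> z []].
    rewrite mulr0 (_ : _ `&` _ = set0) ?measure0//; apply/seteqP; split=> z //=.
    rewrite !in_itv /= => -[z1 z2]; move/negP: juv; apply.
    rewrite /u /v (_ : j%:R = n%:R * (j%:R / n%:R)); last first.
      by rewrite mulrC divfK// gt_eqF.
    by rewrite !ler_pM2l//; lra.
  apply: le_trans (lee_sum _ (fun j _ => slice1 j)) _.
  rewrite sumEFin lee_fin -mulr_sumr /K mulrC ler_wpM2r//.
  rewrite (_ : \sum_(j <- _) _ =
      (count (fun j : nat => u <= j%:R <= v) (iota 0 n))%:R); last first.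
    by rewrite -sum1_count natr_sum [RHS]big_mkcond /=; apply: eq_bigr => j _;
       case: ifP.
  by apply: le_trans (count_nat_itv _ _) _; lra.
have mslice j : measurable_fun setT (slice j).
  exact: (measurable_fun_xsection leb1 (mS _)).
(* The total area is the integral of the summed slices, which are bounded by [K] on [J] and vanish
   elsewhere; [J] has length at most [Num.min (2 * r) W]. *)
rewrite (_ : \sum_(j <- _) _ = \int[leb1]_x \sum_(j <- iota 0 n) slice j x)%E;
  last by rewrite ge0_integral_sum.
apply: (@le_trans _ _ (\int[leb1]_x (K * \1_J x)%:E)%E).
  apply: ge0_le_integral => //.
  - by move=> x _; apply: sume_ge0.
  - exact: emeasurable_sum.
  - apply/measurable_EFinP; exact: measurable_funM.
under eq_integral do rewrite EFinM.
rewrite ge0_integralZl//; last first.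
  by apply/measurable_EFinP; exact: measurable_indic.
rewrite integral_indic// setIT.
rewrite [in leRHS]mulrC [in leRHS]EFinM lee_wpmul2l ?lee_fin//.
rewrite EFin_min le_min; apply/andP; split.
  rewrite (_ : 2 * r = y.1 + r - (y.1 - r)); last ring.
  by apply: leb1_le_itv => //; [lra|move=> z []].
by rewrite -[W]subr0; apply: leb1_le_itv => // z [].
Qed.

End planar_lebesgue.

(** * Open sets, supports and the fixed box *)

Section supports.
Context {R : realType}.
Implicit Types mu : {measure set (R * R) -> \bar R}.

Lemma square_ball (x q : R * R) (r e : R) : 0 < r -> 2 * r < e ->
  `|x.1 - q.1| < r -> `|x.2 - q.2| < r -> square q r `<=` ball x e.
Proof.
move=> r0 re; rewrite !ltr_norml => x1 x2 z; rewrite /square /= !in_itv /=.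
move=> [z1 z2].
split.
  by change (`|x.1 - z.1| < e); rewrite ltr_norml; lra.
by change (`|x.2 - z.2| < e); rewrite ltr_norml; lra.
Qed.

(** An open set is the union of the countably many squares with rational centre and half-side
    [1 / (k + 1)] that it contains. *)
Lemma open_measurable2 (U : set (R * R)%type) : open U -> measurable U.
Proof.
move=> oU.
pose F (i : rat * rat * nat) : set (R * R)%type :=
  let Q := square (ratr i.1.1, ratr i.1.2) i.2.+1%:R^-1 in
  if `[< Q `<=` U >] then Q else set0.
have -> : U = \bigcup_i F i; last first.
  apply: countable_bigcupT_measurable => // i; rewrite /F.
  by case: ifP => // _; exact: measurable_square.
apply/seteqP; split=> [x Ux|x [i _]]; last first.
  by rewrite /F; case: ifP => // /asboolP QU /QU.
have [e /= e0 xeU] : nbhs_ball x U.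
  by apply/nbhs_ballP; exact: (open_nbhs_nbhs (conj oU Ux)).
have e20 : 0 < e / 2 by lra.
have [k] := ltr_add_invr e20; rewrite add0r => ke.
have k0 : 0 < k.+1%:R^-1 :> R by rewrite invr_gt0 ltr0n.
set d : R := k.+1%:R^-1 in ke k0.
have near (a : R) : exists q : rat, `|a - ratr q| < d.
  have [|q] := @rat_in_itvoo R (a - d) (a + d); first by lra.
  by rewrite in_itv /= => qa; exists q; rewrite ltr_norml; lra.
have [q1 xq1] := near x.1; have [q2 xq2] := near x.2.
exists (q1, q2, k) => //; rewrite /F /= -/d asboolT; last first.
  by apply: subset_trans xeU; apply: square_ball => //; lra.
by move: xq1 xq2; rewrite /square /= !in_itv /= !ltr_norml; lra.
Qed.

Lemma closed_msupport mu : closed (msupport mu).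
Proof.
rewrite -openC openE => x /= /existsNP[U /not_implyP[[oU Ux] U0]].
apply: filterS (open_nbhs_nbhs (conj oU Ux)) => z Uz /(_ U (conj oU Uz)).
exact: U0.
Qed.

Lemma msupport_sub mu (K : set (R * R)%type) : closed K -> mu (~` K) = 0%E ->
  msupport mu `<=` K.
Proof.
move=> cK K0 x xmu; apply: contrapT => Kx.
have := xmu (~` K) (conj (closed_openC cK) Kx).
by rewrite K0 ltxx.
Qed.

Lemma ediam_ge0 (S : set (R * R)%type) : 0 <= ediam S.
Proof.
rewrite /ediam; set X := [set _ | _ in _].
(* If [X] has no supremum, [sup] takes the default value 0. *)
have [[[x Xx] ubX]|noX] := pselect (has_sup X); last first.
  by rewrite sup_out.
apply: le_trans (ub_le_sup ubX Xx).
by case: Xx => z _ <-; exact: sqrtr_ge0.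
Qed.

(** Half-side 3 makes room for the strips: the second coordinate of a point of a strip is
    [a * x.1 + b + v], where all three terms will be at most 1 in absolute value. *)
Definition box : set (R * R)%type := square (0, 0) 3.

Lemma compact_box : compact box.
Proof. by apply: compact_setX; exact: segment_compact. Qed.

Lemma closed_box : closed box.
Proof. exact: compact_closed (@norm_hausdorff _ _) compact_box. Qed.

Lemma leb2_box : leb2 box = 36%:E.
Proof.
rewrite /box /square leb2X//= leb1_itvcc; last lra.
by rewrite -EFinM; congr EFin; lra.
Qed.

Lemma leb2_eball_box (y : R * R) (r : R) : 0 < r ->
  (leb2 (eball y r `&` box) <= (Num.min (4 * r ^+ 2) 36)%:E)%E.
Proof.
move=> r0; have mE := measurable_eball y r0.
have mb : measurable box by exact: measurable_square.
rewrite EFin_min le_min; apply/andP; split; last first.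
  by rewrite -leb2_box le_measure ?inE//; exact: measurableI.
apply: (@le_trans _ _ (leb2 (square y r))).
  apply: le_measure; rewrite ?inE; [exact: measurableI|exact: measurable_square|].
  by move=> z [/(eball_square r0)].
rewrite /square leb2X// !leb1_itvcc; [|lra|lra].
by rewrite -EFinM lee_fin; lra.
Qed.

End supports.

(** * Test measures *)

Section test_measures.
Context {R : realType}.

Lemma measurable_box : measurable (@box R).
Proof. exact: measurable_square. Qed.

Definition phase (p t : R) (x : R * R) : R := - (2 * pi * dotp (t, t `^ p) x).

Lemma cmod_fourier (mu : {measure set (R * R) -> \bar R}) (p t : R) :
  cmod (fourier mu (t, t `^ p)) ^+ 2 =
  (\int[mu]_x cos (phase p t x)) ^+ 2 + (\int[mu]_x sin (phase p t x)) ^+ 2.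
Proof.
rewrite /cmod /fourier /cintegral /ComplexField.Normc.normc /= sqr_sqrtr//.
by rewrite addr_ge0 ?sqr_ge0.
Qed.

Lemma measurable_phase2 (p : R) :
  measurable_fun setT (fun z : R * (R * R) => phase p z.1 z.2).
Proof.
rewrite /phase /dotp /=; apply: measurableT_comp => //.
apply: measurable_funM => //; apply: measurable_funD.
  apply: measurable_funM => //.
  exact: (measurableT_comp measurable_fst measurable_snd).
apply: measurable_funM => //.
  by apply: (measurableT_comp (measurable_powR p)); exact: measurable_fst.
by exact: (measurableT_comp measurable_snd measurable_snd).
Qed.

Lemma measurable_phase (p t : R) : measurable_fun setT (phase p t).
Proof.
exact: (measurableT_comp (measurable_phase2 p) (pair1_measurable t)).
Qed.

(** Adding 1 to [g] makes the integrand nonnegative, so that Tonelli's theorem gives measurability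
    in [t]; the measure of [E] is then subtracted. *)
Lemma measurable_oscillatory (g : R -> R) (p : R) (E : set (R * R)%type) :
  measurable E -> (leb2 E < +oo)%E -> measurable_fun setT g ->
  (forall x, `|g x| <= 1) ->
  measurable_fun setT (fun t => \int[leb2]_(x in E) g (phase p t x)).
Proof.
move=> mE Eoo mg g1.
pose f (z : R * (R * R)) := ((1 + g (phase p z.1 z.2)) * \1_E z.2)%:E.
have mf : measurable_fun setT f.
  apply/measurable_EFinP; apply: measurable_funM.
    apply: measurable_funD => //; apply: (measurableT_comp mg).
    exact: measurable_phase2.
  by apply: (measurableT_comp (measurable_indic mE)); exact: measurable_snd.
have f0 z : (0 <= f z)%E.
  rewrite lee_fin mulr_ge0//.
  by have := g1 (phase p z.1 z.2); rewrite ler_norml; lra.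
have -> : (fun t => \int[leb2]_(x in E) g (phase p t x)) =
    (fun t => fine (fubini_F leb2 f t) - fine (leb2 E)).
  apply/funext => t.
  have mgt : measurable_fun setT (fun x => g (phase p t x)).
    by apply: (measurableT_comp mg); exact: measurable_phase.
  have ig : leb2.-integrable E (EFin \o (fun x => g (phase p t x))).
    exact: bounded1_integrable.
  have i1 : leb2.-integrable E (EFin \o cst (1 : R)).
    by apply: bounded1_integrable => // x; rewrite normr1.
  rewrite -[fine (leb2 E)]mul1r -Rintegral_cst//.
  apply/eqP; rewrite eq_sym subr_eq addrC -RintegralD//; apply/eqP.
  rewrite /fubini_F /Rintegral; congr fine; rewrite [RHS]integral_mkcond.
  apply: eq_integral => x _; rewrite /f patchE indicE.
  by case: ifP => _; rewrite ?mulr1 ?mulr0.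
apply: measurable_funB => //; apply: measurableT_comp => //.
exact: measurable_fun_fubini_tonelli_F.
Qed.

Lemma measurable_cos : measurable_fun setT (@cos R).
Proof. by apply: continuous_measurable_fun; exact: continuous_cos. Qed.

Lemma measurable_sin : measurable_fun setT (@sin R).
Proof. by apply: continuous_measurable_fun; exact: continuous_sin. Qed.

Variables (h : {nonneg R}) (E : nat -> set (R * R)%type).
Hypothesis mE : forall j, measurable (E j).
Hypothesis Ebox : forall j, E j `<=` box.

(* Thanks to the summand on [box], the support does not depend on [s]. *)
Fixpoint test_measure (s : seq nat) : {measure set (R * R) -> \bar R} :=
  if s is j :: s' then
    measure_add (mscale h (mrestr leb2 (mE j))) (test_measure s')
  else mrestr leb2 measurable_box.

Lemma test_measureE s A : test_measure s A =
  (leb2 (A `&` box) + h%:num%:E * \sum_(j <- s) leb2 (A `&` E j))%E.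
Proof.
elim: s => [|j s ih]; first by rewrite big_nil mule0 adde0.
rewrite [LHS]measure_addE ih big_cons ge0_muleDr//; last exact: sume_ge0.
by rewrite addeCA.
Qed.

Lemma leb2_sub_box (A : set (R * R)%type) : measurable A -> A `<=` box ->
  (leb2 A < +oo)%E.
Proof.
move=> mA Abox; apply: (@le_lt_trans _ _ (leb2 (@box R))).
  by rewrite le_measure ?inE//; exact: measurable_box.
by rewrite leb2_box ltry.
Qed.

Lemma Rintegral_test_measure s (f : R * R -> R) : measurable_fun setT f ->
  (forall x, `|f x| <= 1) ->
  \int[test_measure s]_x f x = \int[leb2]_(x in box) f x +
    \sum_(j <- s) h%:num * \int[leb2]_(x in E j) f x.
Proof.
move=> mf f1; have mbox := measurable_box.
have boxoo : (leb2 (@box R) < +oo)%E by exact: leb2_sub_box.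
have Eoo j : (leb2 (E j) < +oo)%E by exact: leb2_sub_box.
elim: s => [|j s ih] /=.
  by rewrite big_nil addr0 Rintegral_mrestr.
have int (m : {measure set (R * R) -> \bar R}) :
    (m setT < +oo)%E -> m.-integrable setT (EFin \o f).
  by move=> moo; exact: bounded1_integrable.
rewrite Rintegral_measure_add; last 2 first.
- apply: int; change (h%:num%:E * leb2 (setT `&` E j) < +oo)%E.
  by rewrite setTI lte_mul_pinfty.
- apply: int; rewrite test_measureE setTI lte_add_pinfty// lte_mul_pinfty//.
  by apply: lte_sum_pinfty => i _; rewrite setTI.
rewrite ih Rintegral_mscale; last first.
  by apply: int; change (leb2 (setT `&` E j) < +oo)%E; rewrite setTI.
by rewrite Rintegral_mrestr//; [rewrite big_cons addrCA|exact: Eoo].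
Qed.

(** The pieces lie in [box], so an open set has positive test measure exactly when it meets [box] in
    positive Lebesgue measure. *)
Lemma msupport_test_measure s : msupport (test_measure s) = msupport (test_measure [::]).
Proof.
apply/seteqP; split=> x xmu U Ux; have {xmu} := xmu U Ux; have [oU _] := Ux.
  rewrite !test_measureE big_nil mule0 adde0 => h0.
  rewrite lt_def measure_ge0 andbT; apply/eqP => U0; move: h0.
  rewrite U0 add0e big1_seq ?mule0 ?ltxx// => j _.
  apply: subset_measure0 U0; last by apply: setIS; exact: Ebox.
  - apply: measurableI => //; exact: open_measurable2.
  - apply: measurableI; [exact: open_measurable2|exact: measurable_box].
rewrite !test_measureE big_nil mule0 adde0 => h0.
by apply: lt_le_trans h0 _; rewrite leeDl// mule_ge0// sume_ge0.
Qed.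

Lemma compact_msupport_test_measure s : compact (msupport (test_measure s)).
Proof.
rewrite msupport_test_measure; apply: subclosed_compact compact_box _.
  exact: closed_msupport.
apply: msupport_sub; first exact: closed_box.
by rewrite test_measureE big_nil mule0 adde0 setICl measure0.
Qed.

End test_measures.

Lemma lee_sum_subseq (R : realDomainType) (T : eqType) (s r : seq T)
    (f : T -> \bar R) : uniq r -> subseq s r -> (forall j, 0 <= f j)%E ->
  (\sum_(j <- s) f j <= \sum_(j <- r) f j)%E.
Proof.
move=> ur sr f0; rewrite ((subseq_uniqP ur) sr) big_filter big_mkcond /=.
by apply: lee_sum => j _; case: ifP.
Qed.

(** * Reduction of the ball condition to radii at most 1 *)

Section combs.
Context {R : realType}.
Variable alpha : R.
Hypothesis alpha02 : 0 < alpha < 2.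

(** The ball condition for the box: [alpha < 2] settles small radii, the total mass 36 large
    ones. *)
Lemma sqr_le_powR (r : R) : 0 < r -> Num.min (4 * r ^+ 2) 36 <= 36 * r `^ alpha.
Proof.
have /andP[alpha0 alpha2] := alpha02.
move=> r0; have ra0 := powR_ge0 r alpha.
have [r1|r1] := leP r 1.
  rewrite ge_min; apply/orP; left.
  have : r `^ 2%:R <= r `^ alpha.
    by apply: ger_powR; [rewrite r0 r1|exact: ltW].
  by rewrite powR_mulrn ?(ltW r0)//; lra.
rewrite ge_min; apply/orP; right.
have : r `^ 0 <= r `^ alpha by apply: ler_powR; lra.
rewrite powRr0; lra.
Qed.

(** The box contributes 36. Any subfamily of the pieces is dominated by the full comb of strips, and
    a ball by its circumscribed square. *)
Lemma comb_eball (A W H a : R) (h : {nonneg R}) (n : nat)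
    (E : nat -> set (R * R)%type) (mE : forall j, measurable (E j)) :
  0 <= W <= 1 -> 0 <= H -> (0 < n)%N -> n%:R * H <= 1 ->
  (forall j, (j < n)%N -> E j `<=` strip W H a (j%:R / n%:R)) ->
  (forall r, 0 < r <= 1 ->
    h%:num * (Num.min (2 * r) W * ((2 * r * n%:R + 2) * Num.min H (2 * r))) <=
    A * r `^ alpha) ->
  forall s y r, s \in sublists (iota 0 n) -> 0 < r ->
  (test_measure h mE s (eball y r) <= ((36 + A) * r `^ alpha)%:E)%E.
Proof.
have /andP[alpha0 alpha2] := alpha02.
move=> /andP[W0 W1] H0 n0 nH Estrip hA s y r /sublists_subseq ss r0.
have h0 : 0 <= h%:num by [].
have n1 : 1 <= n%:R :> R by rewrite ler1n.
have mb := measurable_eball y r0.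
have ra0 := powR_ge0 r alpha.
rewrite test_measureE mulrDl EFinD leeD//.
  by apply: le_trans (leb2_eball_box y r0) _; rewrite lee_fin sqr_le_powR.
have le_strips : (\sum_(j <- s) leb2 (eball y r `&` E j) <=
    \sum_(j <- iota 0 n) leb2 (eball y r `&` strip W H a (j%:R / n%:R)))%E.
  apply: le_trans (lee_sum_subseq (iota_uniq 0 n) ss _) _ => //.
  rewrite !big_seq; apply: lee_sum => j; rewrite mem_iota => /andP[_ jn].
  apply: le_measure; rewrite ?inE.
  - exact: measurableI.
  - by apply: measurableI => //; exact: measurable_strip.
  - by apply: setIS; exact: Estrip.
apply: (@le_trans _ _ (h%:num%:E * \sum_(j <- iota 0 n)
    leb2 (eball y r `&` strip W H a (j%:R / n%:R)))%E).
  by rewrite lee_wpmul2l.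
have [r1|r1] := leP r 1.
  apply: (@le_trans _ _ (h%:num%:E * \sum_(j <- iota 0 n)
      leb2 (square y r `&` strip W H a (j%:R / n%:R)))%E).
    rewrite lee_wpmul2l//; apply: lee_sum => j _; apply: le_measure; rewrite ?inE.
    - by apply: measurableI => //; exact: measurable_strip.
    - by apply: measurableI; [exact: measurable_square|exact: measurable_strip].
    - by apply: setSI; exact: eball_square.
  apply: le_trans (lee_wpmul2l _ (sum_leb2_strips _ _ W0 H0 r0 n0 nH)) _ => //.
  by rewrite -EFinM lee_fin hA// r0.
apply: (@le_trans _ _ (h%:num%:E * \sum_(j <- iota 0 n) (W * H)%:E)%E).
  rewrite lee_wpmul2l//; apply: lee_sum => j _.
  rewrite -(leb2_strip a (j%:R / n%:R))//; apply: le_measure; rewrite ?inE.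
  - by apply: measurableI => //; exact: measurable_strip.
  - exact: measurable_strip.
  - exact: subIsetr.
rewrite sumEFin -EFinM lee_fin big_const_seq count_predT size_iota iter_addr_0.
have H1 : H <= 1 by nra.
(* For [r > 1] the total mass of the comb suffices. At radius 1 the two minima are [W] and [H], so
   the assumption yields [h * n * W * H <= A]. *)
have := hA 1; rewrite ltr01 lexx powR1 !mulr1 => /(_ isT).
rewrite (min_idPr _); last lra.
rewrite (min_idPl _); last lra.
rewrite -mulr_natr => hWH.
have hWH0 : 0 <= h%:num * (W * H) by rewrite !mulr_ge0.
have A0 : 0 <= A by apply: le_trans hWH; rewrite !mulr_ge0//; lra.
have : 1 <= r `^ alpha.
  by rewrite -(powRr0 r); apply: ler_powR; lra.
have : h%:num * (W * H) * n%:R <= A by nra.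
nra.
Qed.

End combs.

(** * The energy of one piece *)

Section test.
Context {R : realType}.
Variables (p alpha gamma : R).
Hypothesis alpha02 : 0 < alpha < 2.
Hypothesis restriction : forall A d : R, 0 < A -> 0 <= d ->
  exists C : R, forall mu : {measure set (R * R) -> \bar R},
    compact (msupport mu) -> ediam (msupport mu) = d ->
    (forall (y : R * R) (r : R), 0 < r ->
      (mu (eball y r) <= (A * r `^ alpha)%:E)%E) ->
    (\int[lebesgue_measure]_(t in `]0%R, +oo[)
      (cmod (fourier mu (t, t `^ p)) ^+ 2 * t `^ gamma)%:E <= C%:E)%E.

Lemma strip_sub_box (W H a : R) (n j : nat) : W <= 1 -> `|a| <= 1 ->
  (0 < n)%N -> n%:R * H <= 1 -> 0 <= H -> (j < n)%N ->
  strip W H a (j%:R / n%:R) `<=` box.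
Proof.
move=> W1; rewrite ler_norml => a1 n0 nH H0 jn x [x1 x2].
have n0' : 0 < n%:R :> R by rewrite ltr0n.
have n1 : 1 <= n%:R :> R by rewrite ler1n.
have H1 : H <= 1 by nra.
have jn1 : j%:R / n%:R <= 1 :> R by rewrite ler_pdivrMr// mul1r ler_nat ltnW.
have jn0 : 0 <= j%:R / n%:R :> R by rewrite divr_ge0.
have : -1 <= a * x.1 <= 1 by nra.
by rewrite /box /square /= !in_itv /=; lra.
Qed.

Lemma measurable_energy (h : {nonneg R}) E mE s :
  (forall j, E j `<=` box) ->
  measurable_fun setT
    (fun t => cmod (fourier (test_measure h (E := E) mE s) (t, t `^ p)) ^+ 2).
Proof.
move=> Ebox.
have meas (g : R -> R) : measurable_fun setT g -> (forall x, `|g x| <= 1) ->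
    measurable_fun setT
      (fun t => \int[test_measure h mE s]_x g (phase p t x)).
  move=> mg g1.
  rewrite (_ : (fun t => _) = fun t => \int[leb2]_(x in box) g (phase p t x) +
    \sum_(j <- s) h%:num * \int[leb2]_(x in E j) g (phase p t x)); last first.
    apply/funext => t; apply: Rintegral_test_measure => //.
    by apply: (measurableT_comp mg); exact: measurable_phase.
  apply: measurable_funD.
    by apply: measurable_oscillatory => //;
      [exact: measurable_box|rewrite leb2_box ltry].
  apply: measurable_sum => j; apply: measurable_funM => //.
  by apply: measurable_oscillatory => //; exact: leb2_sub_box.
under eq_fun do rewrite cmod_fourier.
apply: measurable_funD; apply: measurable_funX; apply: meas.
- exact: measurable_cos.
- by move=> x; rewrite ler_norml cos_geN1 cos_le1.
- exact: measurable_sin.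
- exact: sin_max.
Qed.

(** All test measures have the same support and satisfy the ball condition with the constant
    [36 + A], so a single constant of the hypothesis serves all parameters. [T0] is the base point
    of the phase, [[s0, s1]] the range of [t] where the phase stays close to it up to constants. *)
Lemma energy_bound (A : R) : 0 < A -> exists C : R,
  forall (n : nat) (W H a h T0 s0 s1 : R),
  (0 < n)%N -> 0 <= W <= 1 -> 0 <= H -> n%:R * H <= 1 -> `|a| <= 1 -> 0 <= h ->
  0 < s0 ->
  (forall r, 0 < r <= 1 ->
    h * (Num.min (2 * r) W * ((2 * r * n%:R + 2) * Num.min H (2 * r))) <=
    A * r `^ alpha) ->
  (forall t j, s0 <= t <= s1 -> (j < n)%N -> exists k : R,
    forall x, strip W H a (j%:R / n%:R) x ->
      `|phase p t x - phase p T0 x - k| <= 1 / 4) ->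
  ((n%:R * (h ^+ 2 * (W * H) ^+ 2))%:E *
    \int[lebesgue_measure]_(t in `[s0, s1]) (t `^ gamma)%:E <= C%:E)%E.
Proof.
move=> A0; set d := ediam (msupport (mrestr leb2 (@measurable_box R))).
have A36 : 0 < 36 + A by lra.
have [C C_bound] := restriction A36 (ediam_ge0 _ : 0 <= d).
(* [512 = 4 * 128], with 4 from the summation over sublists and 128 from the quadrant argument; the
   factors [2 ^ n] cancel. *)
exists (512 * C).
move=> n W H a h T0 s0 s1 n0 W01 H0 nH a1 h0 s00 hA near_phase.
have /andP[W0 W1] := W01.
have hn : exists hn : {nonneg R}, hn%:num = h by exists (NngNum h0).
case: hn => {h0} hn <- in hA *.
have /choice[E hE] : forall j, exists E : set (R * R)%type,
  [/\ measurable E, E `<=` box & (j < n)%N ->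
    E `<=` strip W H a (j%:R / n%:R) /\
    forall t, s0 <= t <= s1 -> (W * H) ^+ 2 / 128 <=
      (\int[leb2]_(x in E) cos (phase p t x)) ^+ 2 +
      (\int[leb2]_(x in E) sin (phase p t x)) ^+ 2].
  (* Indices [j >= n] occur in no sublist; the empty set is a filler there. *)
  move=> j; have [jn|jn] := ltnP j n; last by exists set0; split.
  have Poo : (leb2 (strip W H a (j%:R / n%:R)) < +oo)%E.
    by rewrite leb2_strip// ltry.
  have [E [mE EP Ecs]] := exists_no_cancellation
    (measurable_strip W H a (j%:R / n%:R)) Poo (measurable_phase p T0).
  exists E; split => //.
    by apply: subset_trans EP _; exact: strip_sub_box.
  move=> _; split=> // t /near_phase /(_ jn) [k tk].
  have -> : W * H = fine (leb2 (strip W H a (j%:R / n%:R))).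
    by rewrite leb2_strip.
  exact: Ecs (measurable_phase p t) tk.
have mE j : measurable (E j) by have [] := hE j.
have Ebox j : E j `<=` box by have [] := hE j.
pose mu s := test_measure hn mE s.
pose F s t := cmod (fourier (mu s) (t, t `^ p)) ^+ 2 * t `^ gamma.
have muC s : s \in sublists (iota 0 n) ->
    (\int[lebesgue_measure]_(t in `]0%R, +oo[) (F s t)%:E <= C%:E)%E.
  move=> ss; apply: C_bound.
  - exact: compact_msupport_test_measure.
  - by rewrite /d /mu msupport_test_measure.
  - move=> y r r0; apply: (@comb_eball _ _ alpha02 A W H a hn n) => // j jn.
    by have [_ _ /(_ jn) []] := hE j.
have F0 s t : 0 <= F s t by rewrite mulr_ge0 ?sqr_ge0// powR_ge0.
have mF s : measurable_fun setT (fun t => (F s t)%:E).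
  apply/measurable_EFinP; apply: measurable_funM; last exact: measurable_powR.
  exact: measurable_energy.
set c := 2 ^+ n / 4 * (n%:R * (hn%:num ^+ 2 * ((W * H) ^+ 2 / 128))).
have Fc t : s0 <= t <= s1 -> c * t `^ gamma <= \sum_(s <- sublists (iota 0 n)) F s t.
  move=> ts; rewrite -mulr_suml /c.
  have t0 : 0 <= t `^ gamma := powR_ge0 _ _.
  apply: ler_wpM2r => //.
  pose z g j := hn%:num * \int[leb2]_(x in E j) g (phase p t x).
  pose b g := \int[leb2]_(x in box) g (phase p t x).
  rewrite (eq_bigr (fun s => (b (@cos R) + \sum_(j <- s) z (@cos R) j) ^+ 2 +
                             (b (@sin R) + \sum_(j <- s) z (@sin R) j) ^+ 2)); last first.
    move=> s _; rewrite cmod_fourier !Rintegral_test_measure//.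
    - by apply: (measurableT_comp measurable_sin); exact: measurable_phase.
    - by move=> x; exact: sin_max.
    - by apply: (measurableT_comp measurable_cos); exact: measurable_phase.
    - by move=> x; rewrite ler_norml cos_geN1 cos_le1.
  rewrite big_split /=.
  (* The cosine and sine integrals are treated separately, the box integral playing the role of the
     fixed term [g]. *)
  have := sum_sublists_sqr (b (@cos R)) (z (@cos R)) (iota 0 n).
  have := sum_sublists_sqr (b (@sin R)) (z (@sin R)) (iota 0 n).
  move=> hs hc; apply: le_trans (lerD hc hs).
  rewrite size_iota -mulrDr -big_split /= ler_wpM2l ?divr_ge0 ?exprn_ge0//.
  rewrite (_ : n%:R * _ = \sum_(j <- iota 0 n)
      hn%:num ^+ 2 * ((W * H) ^+ 2 / 128)); last first.
    by rewrite big_const_seq count_predT size_iota iter_addr_0 mulr_natl.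
  rewrite big_seq [leRHS]big_seq.
  apply: ler_sum => j; rewrite mem_iota => /andP[_ jn].
  rewrite /z !exprMn -mulrDr ler_wpM2l ?sqr_ge0//.
  by have [_ _ /(_ jn) [_ /(_ t ts)]] := hE j; rewrite exprMn.
have c0 : 0 <= c.
  by rewrite !mulr_ge0// ?sqr_ge0// ?exprn_ge0// divr_ge0// sqr_ge0.
have upper : (\int[lebesgue_measure]_(t in `]0%R, +oo[)
    \sum_(s <- sublists (iota 0 n)) (F s t)%:E <= (2 ^+ n * C)%:E)%E.
  rewrite ge0_integral_sum//; last 2 first.
  - by move=> s; apply: measurable_funTS; exact: mF.
  - by move=> s t _; rewrite lee_fin.
  apply: (@le_trans _ _ (\sum_(s <- sublists (iota 0 n)) C%:E)%E).
    by rewrite big_seq [leRHS]big_seq; apply: lee_sum.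
  rewrite sumEFin lee_fin big_const_seq count_predT size_sublists size_iota.
  by rewrite iter_addr_0 -(mulr_natl _ (2 ^ n)) natrX.
have mpow : measurable_fun `[s0, s1]%classic (fun t : R => (t `^ gamma)%:E).
  by apply: measurable_funTS; apply/measurable_EFinP; exact: measurable_powR.
have pow0 : (0 <= \int[lebesgue_measure]_(t in `[s0, s1]) (t `^ gamma)%:E)%E.
  by apply: integral_ge0 => t _; rewrite lee_fin powR_ge0.
have lower : (c%:E * \int[lebesgue_measure]_(t in `[s0, s1]) (t `^ gamma)%:E <=
    \int[lebesgue_measure]_(t in `]0%R, +oo[)
    \sum_(s <- sublists (iota 0 n)) (F s t)%:E)%E.
  rewrite -ge0_integralZl//; last by move=> t _; rewrite lee_fin powR_ge0.
  apply: (@le_trans _ _ (\int[lebesgue_measure]_(t in `[s0, s1])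
      \sum_(s <- sublists (iota 0 n)) (F s t)%:E)%E).
    apply: ge0_le_integral => //.
    - by move=> t _; rewrite -EFinM lee_fin mulr_ge0// powR_ge0.
    - by apply: measurable_funeM.
    - apply: emeasurable_sum => s; apply: measurable_funTS; exact: mF.
    - by move=> t; rewrite /= in_itv /= => ts; rewrite sumEFin -EFinM lee_fin Fc.
  apply: ge0_subset_integral => //.
  - apply: emeasurable_sum => s; apply: measurable_funTS; exact: mF.
  - by move=> t _; apply: sume_ge0 => s _; rewrite lee_fin.
  - by move=> t; rewrite /= !in_itv /= andbT; lra.
have := le_trans lower upper.
have -> : n%:R * (hn%:num ^+ 2 * (W * H) ^+ 2) = 512 / 2 ^+ n * c.
  by rewrite /c; field.
have N0 : 0 < 2 ^+ n :> R by rewrite exprn_gt0.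
have k0 : (0 <= (512 / 2 ^+ n)%:E :> \bar R)%E.
  by rewrite lee_fin; apply: divr_ge0; [exact: ler0n|exact: ltW].
move=> /(lee_wpmul2l k0); rewrite muleA -EFinM => /le_trans; apply.
by rewrite -EFinM lee_fin mulrA divfK// gt_eqF.
Qed.

End test.

(** * Choice of the parameters *)

Section cases.
Context {R : realType}.
Implicit Types p alpha gamma t T : R.

Lemma powR_ge_dyadic gamma T t : 0 < T -> T <= t <= 2 * T ->
  T `^ gamma * Num.min 1 (2 `^ gamma) <= t `^ gamma.
Proof.
move=> T0 /andP[Tt t2T]; have t0 : 0 < t by lra.
have Tg := powR_ge0 T gamma.
have [g0|g0] := leP 0 gamma.
  apply: (@le_trans _ _ (T `^ gamma)).
    by rewrite ler_piMr// ge_min lexx.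
  by apply: ge0_ler_powR; rewrite ?nnegrE//; lra.
apply: (@le_trans _ _ (T `^ gamma * 2 `^ gamma)).
  by rewrite ler_wpM2l// ge_min lexx orbT.
rewrite -powRM; try lra.
rewrite -[gamma]opprK 2!(powRN _ (- gamma)) lef_pV2 ?posrE ?powR_gt0//; last lra.
by apply: ge0_ler_powR; rewrite ?nnegrE; lra.
Qed.

Lemma integral_powR_ge gamma (s0 s1 m : R) : s0 <= s1 -> 0 <= m ->
  (forall t, s0 <= t <= s1 -> m <= t `^ gamma) ->
  ((m * (s1 - s0))%:E <=
   \int[lebesgue_measure]_(t in `[s0, s1]) (t `^ gamma)%:E)%E.
Proof.
move=> s01 m0 tm.
apply: (@le_trans _ _ (\int[lebesgue_measure]_(t in `[s0, s1]) m%:E)%E).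
  rewrite integral_cst//= lebesgue_measure_itv /= lte_fin.
  case: ltP => s01'; first by rewrite EFinM.
  by rewrite mule0 lee_fin; nra.
apply: ge0_le_integral => //.
by apply: measurable_funTS; apply/measurable_EFinP; exact: measurable_powR.
Qed.

(** On []0, 1]] the integrand dominates [t^-1], which has antiderivative [ln]. The logarithmic
    divergence at 0 will exclude [gamma <= -1]. *)
Lemma integral_inv_ge gamma (s0 s1 : R) : gamma <= -1 -> 0 < s0 < s1 -> s1 <= 1 ->
  ((ln s1 - ln s0)%:E <=
   \int[lebesgue_measure]_(t in `[s0, s1]) (t `^ gamma)%:E)%E.
Proof.
move=> g1 /andP[s00 s01] s11.
have cinv : {within `[s0, s1], continuous (fun t : R => t^-1)}.
  apply: continuous_in_subspaceT => t; rewrite inE /= in_itv /= => /andP[ts _].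
  by apply: inv_continuous; rewrite gt_eqF//; lra.
have <- : (\int[lebesgue_measure]_(t in `[s0, s1]) (t^-1)%:E =
    (ln s1 - ln s0)%:E)%E.
  rewrite (continuous_FTC2 (F := @ln R) s01 cinv)//.
    split.
    - move=> t; rewrite in_itv /= => /andP[ts _].
      by apply: ex_derive; apply: is_derive1_ln; lra.
    - by apply: cvg_at_right_filter; apply: continuous_ln.
    - by apply: cvg_at_left_filter; apply: continuous_ln; lra.
  move=> t; rewrite in_itv /= => /andP[ts _].
  rewrite derive1E; apply: derive_val; apply: is_derive1_ln; lra.
apply: ge0_le_integral => //.
- by move=> t; rewrite /= in_itv /= => ts; rewrite lee_fin invr_ge0; lra.
- apply/measurable_EFinP.
  by apply: subspace_continuous_measurable_fun.
- apply: measurable_funTS; apply/measurable_EFinP; exact: measurable_powR.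
- move=> t; rewrite /= in_itv /= => ts; rewrite lee_fin -powR_inv1; last lra.
  by apply: ger_powR => //; lra.
Qed.

(** With [x.2 = a * x.1 + b + v] and [q = t ^ p - T0 ^ p], the phase difference is [- 2 * pi * ((t -
    T0 + a * q) * x.1 + q * v + q * b)], whose last term is constant on the strip. The factor 8
    comes from [pi < 4]. *)
Lemma phase_strip p (W H a b t T0 : R) (x : R * R) :
  0 <= W -> 0 <= H -> strip W H a b x ->
  `|phase p t x - phase p T0 x - (- (2 * pi * (t `^ p - T0 `^ p) * b))| <=
  8 * (`|t - T0 + a * (t `^ p - T0 `^ p)| * W + `|t `^ p - T0 `^ p| * H).
Proof.
move=> W0 H0 [/andP[x10 x1W] /andP[v0 vH]].
set q := t `^ p - T0 `^ p; set v := x.2 - a * x.1 - b in v0 vH.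
have -> : phase p t x - phase p T0 x - (- (2 * pi * q * b)) =
    - (2 * pi) * ((t - T0 + a * q) * x.1 + q * v).
  by rewrite /phase /dotp /= /v /q; ring.
have pi0 : 0 < pi :> R := pi_gt0 R.
have pi4 : pi < 4 :> R by have := pihalf_lt2 R; lra.
rewrite normrM normrN (@ger0_norm _ (2 * pi)); last lra.
apply: ler_pM => //; [lra|lra|].
apply: le_trans (ler_normD _ _) _; rewrite !normrM.
by rewrite (ger0_norm x10) (ger0_norm v0) lerD// ler_wpM2l.
Qed.

End cases.

(** * Ball conditions for the two kinds of combs *)

Section cases.
Context {R : realType}.
Implicit Types p alpha beta gamma t T r : R.

Lemma minM_le (a b c d x y z : R) : 0 <= Num.min a b -> 0 <= z -> 0 <= Num.min c d ->
  Num.min a b <= x -> Num.min c d <= y ->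
  Num.min a b * (z * Num.min c d) <= x * (z * y).
Proof.
move=> ab z0 cd abx cdy.
by apply: ler_pM => //; [exact: mulr_ge0|exact: ler_wpM2l].
Qed.

(** At radii below the spacing [1 / m], the bound [2 * r * m + 2] on the number of strips met is at
    most 4. *)
Lemma few_teeth (r m z : R) : 0 <= r -> r * m <= 1 -> 0 <= z ->
  2 * r * ((2 * r * m + 2) * z) <= 2 * r * (4 * z).
Proof.
move=> r0 rm z0; apply: ler_wpM2l; first lra.
by apply: ler_wpM2r => //; lra.
Qed.

Lemma powR_ge_id (x b : R) : 0 < x <= 1 -> b <= 1 -> x <= x `^ b.
Proof.
move=> /andP[x0 x1] b1; rewrite -[leLHS](powRr1 (ltW x0)).
by apply: ger_powR; rewrite ?x0.
Qed.

Lemma powR_ge1 (x b : R) : 1 <= x -> 0 <= b -> 1 <= x `^ b.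
Proof. by move=> x1 b0; rewrite -(powRr0 x); apply: ler_powR. Qed.

Lemma natr_truncn_half (x : R) : 1 <= x ->
  exists n : nat, [/\ (0 < n)%N, n%:R <= x & x / 2 <= n%:R].
Proof.
move=> x1; exists (Num.truncn x).
have /andP[nx xn] := truncn_itv (le_trans ler01 x1).
have n0 : (0 < Num.truncn x)%N.
  rewrite lt0n; apply: contraTneq xn => ->; rewrite -leNgt//.
split=> //; have : 1 <= (Num.truncn x)%:R :> R by rewrite ler1n.
by move: xn; rewrite -natr1; lra.
Qed.

(** With [X = L ^ (beta - 1)] and [Y = r ^ (beta - 1)]: for [r * L <= 1] at most four strips count,
    each with area at most [(2 * r) ^+ 2], and [r * L <= X * Y]. For larger [r] the strips have full
    thickness, and both [r * n] and 1 are at most [X * Y]. *)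
Lemma thin_comb_ball beta (L r : R) (n : nat) :
  1 <= beta < 2 -> 1 <= L -> n%:R <= L `^ (beta - 1) -> 0 < r <= 1 ->
  L / L `^ (beta - 1) *
    (Num.min (2 * r) 1 * ((2 * r * n%:R + 2) * Num.min L^-1 (2 * r))) <=
  16 * r `^ beta.
Proof.
move=> /andP[b1 b2] L1 nX /andP[r0 r1].
have L0 : 0 < L by lra.
set X := L `^ (beta - 1) in nX *; pose Y := r `^ (beta - 1).
have X0 : 0 < X by apply: powR_gt0.
have Y0 : 0 < Y by apply: powR_gt0.
have -> : r `^ beta = r * Y.
  rewrite -[X in X * Y]powRr1 ?ltW// -powRD; first by congr (_ `^ _); ring.
  by apply/implyP => _; rewrite gt_eqF.
have XY : (r * L) `^ (beta - 1) = X * Y by rewrite powRM ?ltW// mulrC.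
have n0 : 0 <= n%:R :> R by [].
have Li0 : 0 < L^-1 by rewrite invr_gt0.
have rn0 : 0 <= 2 * r * n%:R + 2 by rewrite addr_ge0// !mulr_ge0// ltW.
have m1 : 0 <= Num.min (2 * r) 1 by rewrite le_min; lra.
have m2 : 0 <= Num.min L^-1 (2 * r) by rewrite le_min; lra.
have h0 : 0 <= L / X by rewrite divr_ge0// ltW.
have XL : X <= L.
  by rewrite -[leRHS](powRr1 (ltW L0)); apply: ler_powR => //; lra.
have [rL|rL] := leP (r * L) 1.
  have rLXY : r * L <= X * Y.
    by rewrite -XY; apply: powR_ge_id; [rewrite mulr_gt0|lra].
  have rn : r * n%:R <= 1 by nra.
  apply: (@le_trans _ _ (L / X * (2 * r * (4 * (2 * r))))).
    apply: ler_wpM2l => //.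
    apply: (@le_trans _ _ (2 * r * ((2 * r * n%:R + 2) * (2 * r)))).
      by apply: minM_le => //; rewrite ge_min lexx ?orbT.
    by apply: few_teeth => //; lra.
  have -> : L / X * (2 * r * (4 * (2 * r))) = 16 * r * ((r * L) / X).
    by field; rewrite gt_eqF.
  have : r * L / X <= Y by rewrite ler_pdivrMr// [leRHS]mulrC.
  by nra.
have XY1 : 1 <= X * Y by rewrite -XY; apply: powR_ge1; lra.
apply: (@le_trans _ _ (L / X * (2 * r * ((2 * r * n%:R + 2) * L^-1)))).
  apply: ler_wpM2l => //; apply: minM_le => //; rewrite ge_min lexx ?orbT//.
have -> : L / X * (2 * r * ((2 * r * n%:R + 2) * L^-1)) =
    4 * r * ((r * n%:R + 1) / X).
  by field; rewrite !gt_eqF.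
have rY : r <= Y by apply: powR_ge_id; [rewrite r0|lra].
have : (r * n%:R + 1) / X <= 2 * Y.
  by rewrite ler_pdivrMr//; nra.
by nra.
Qed.

(** Three regimes: for [r <= 1 / Q] both sides of a rectangle are cut to [2 * r], for
    [1 / Q < r <= 1 / T] only the width, and for [r > 1 / T] rectangles count in full. Each time the
    bound reduces to comparing with [(r * T) ^ alpha = X * Y]. *)
Lemma point_comb_ball alpha (T Q r : R) (n : nat) :
  0 < alpha <= 1 -> 1 <= T -> T <= Q -> n%:R <= T `^ alpha -> 0 < r <= 1 ->
  T * Q / T `^ alpha *
    (Num.min (2 * r) T^-1 * ((2 * r * n%:R + 2) * Num.min Q^-1 (2 * r))) <=
  16 * r `^ alpha.
Proof.
move=> /andP[a0 a1] T1 TQ nX /andP[r0 r1].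
have T0 : 0 < T by lra.
have Q0 : 0 < Q by lra.
set X := T `^ alpha in nX *; set Y := r `^ alpha.
have X0 : 0 < X by apply: powR_gt0.
have Y0 : 0 < Y by apply: powR_gt0.
have XY : (r * T) `^ alpha = X * Y by rewrite powRM ?ltW// mulrC.
have n0 : 0 <= n%:R :> R by [].
have Ti0 : 0 < T^-1 by rewrite invr_gt0.
have Qi0 : 0 < Q^-1 by rewrite invr_gt0.
have rn0 : 0 <= 2 * r * n%:R + 2 by rewrite addr_ge0// !mulr_ge0// ltW.
have m1 : 0 <= Num.min (2 * r) T^-1 by rewrite le_min; lra.
have m2 : 0 <= Num.min Q^-1 (2 * r) by rewrite le_min; lra.
have h0 : 0 <= T * Q / X by rewrite divr_ge0 ?mulr_ge0// ltW.
have XT : X <= T.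
  by rewrite -[leRHS](powRr1 (ltW T0)); apply: ler_powR => //; lra.
have [rT|rT] := leP (r * T) 1.
  have rTXY : r * T <= X * Y.
    by rewrite -XY; apply: powR_ge_id; [rewrite mulr_gt0|lra].
  have rn : r * n%:R <= 1 by nra.
  have [rQ|rQ] := leP (r * Q) 1.
    apply: (@le_trans _ _ (T * Q / X * (2 * r * (4 * (2 * r))))).
      apply: ler_wpM2l => //.
    apply: (@le_trans _ _ (2 * r * ((2 * r * n%:R + 2) * (2 * r)))).
        by apply: minM_le => //; rewrite ge_min lexx ?orbT.
      by apply: few_teeth => //; lra.
    have -> : T * Q / X * (2 * r * (4 * (2 * r))) = 16 * ((r * Q) * (r * T) / X).
      by field; rewrite gt_eqF.
    rewrite ler_wpM2l// ler_pdivrMr// [leRHS]mulrC.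
    have : 0 < r * T by rewrite mulr_gt0.
    by nra.
  apply: (@le_trans _ _ (T * Q / X * (2 * r * (4 * Q^-1)))).
    apply: ler_wpM2l => //; apply: (@le_trans _ _ (2 * r * ((2 * r * n%:R + 2) * Q^-1))).
      by apply: minM_le => //; rewrite ge_min lexx ?orbT.
    by apply: few_teeth => //; lra.
  have -> : T * Q / X * (2 * r * (4 * Q^-1)) = 8 * ((r * T) / X).
    by field; rewrite !gt_eqF.
  have : r * T / X <= Y by rewrite ler_pdivrMr// [leRHS]mulrC.
  by lra.
have XY1 : 1 <= X * Y by rewrite -XY; apply: powR_ge1; lra.
apply: (@le_trans _ _ (T * Q / X * (T^-1 * ((2 * r * n%:R + 2) * Q^-1)))).
  by apply: ler_wpM2l => //; apply: minM_le => //; rewrite ge_min lexx ?orbT.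
have -> : T * Q / X * (T^-1 * ((2 * r * n%:R + 2) * Q^-1)) = 2 * ((r * n%:R + 1) / X).
  by field; rewrite !gt_eqF.
have rY : r <= Y by apply: powR_ge_id; [rewrite r0|lra].
have : (r * n%:R + 1) / X <= 2 * Y.
  by rewrite ler_pdivrMr//; nra.
by lra.
Qed.

End cases.

(** * Power estimates and the curve near its tangent *)

Lemma powR_le_self (R : realType) (p t s : R) : 1 < p -> 0 <= t -> t <= s ->
  0 < s <= 1 -> t `^ p <= s.
Proof.
move=> p1 t0 ts /andP[s0 s1]; apply: le_trans (_ : s `^ p <= s).
  by apply: ge0_ler_powR; rewrite ?nnegrE//; lra.
rewrite -[leRHS](powRr1 (ltW s0)); apply: ger_powR; rewrite ?s0//.
exact: ltW.
Qed.

Lemma powR_half_sqr (R : realType) (T : R) : 0 < T ->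
  T `^ (1 / 2) * T `^ (1 / 2) = T.
Proof.
move=> T0; rewrite -powRD; last by apply/implyP => _; rewrite gt_eqF.
by rewrite -[RHS](powRr1 (ltW T0)); congr (_ `^ _); field.
Qed.

Lemma powR_sub1M (R : realType) (p T : R) : 0 < T -> T `^ p = T `^ (p - 1) * T.
Proof.
move=> T0; rewrite -[X in _ = _ * X](powRr1 (ltW T0)) -powRD; last first.
  by apply/implyP => _; rewrite gt_eqF.
by rewrite subrK.
Qed.

Lemma powR_sub_half (R : realType) (p T : R) : 0 < T ->
  T `^ (p - 1 / 2) = T `^ (p - 1) * T `^ (1 / 2).
Proof.
move=> T0; rewrite -powRD; last by apply/implyP => _; rewrite gt_eqF.
by congr (_ `^ _); field.
Qed.

(* The first quantity is the horizontal distance from the point [(t, t ^ p)] to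
   the tangent at [(T, T ^ p)]. *)
Lemma tangent_estimates (R : realType) (p T t K : R) : 1 < p -> 1 <= T ->
  K = p ^+ 2 * expR p -> 0 <= t - T <= (100 * K)^-1 * T `^ (1 / 2) ->
  `|t - T + - (p * T `^ (p - 1))^-1 * (t `^ p - T `^ p)| <= 1 / 10000 /\
  `|t `^ p - T `^ p| <= T `^ (p - 1 / 2) / 50.
Proof.
move=> p1 T1 KE /andP[s0 s1]; have T0 : 0 < T by lra.
have p0 : 0 < p by lra.
have pK : p <= K.
  rewrite KE expr2 -mulrA ler_peMr//; first exact: ltW.
  by rewrite mulr_ege1 ?(ltW p1)// -[leLHS]expR0 ler_expR ltW.
have K0 : 0 < K by lra.
rewrite (powR_sub_half p T0); set P := T `^ (p - 1); set S := T `^ (1 / 2) in s1 *.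
have P0 : 0 < P by apply: powR_gt0.
have S0 : 0 < S by apply: powR_gt0.
have S1 : 1 <= S by apply: powR_ge1; lra.
have SS : S * S = T by apply: powR_half_sqr.
set u := (t - T) / T.
have tu : t = T * (1 + u) by rewrite /u mulrDr mulr1 mulrC divfK ?gt_eqF// addrC subrK.
have u0 : 0 <= u by rewrite divr_ge0// ltW.
(* As [T = S * S], the relative increment [u] is at most [1 / (100 * K * S)]. *)
have uS : K * (u * S) <= 1 / 100.
  have : u * S * S <= (100 * K)^-1 * S.
    by rewrite -mulrA SS /u divfK// gt_eqF.
  rewrite ler_pM2r// => uSK; apply: le_trans (ler_wpM2l (ltW K0) uSK) _.
  by rewrite [leLHS](_ : _ = 1 / 100)//; field; rewrite gt_eqF.
have uS0 : 0 <= u * S by rewrite mulr_ge0// ltW.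
have K1 : 1 <= K by lra.
have uS1 : u * S <= 1 / 100.
  by apply: le_trans uS; rewrite ler_peMl.
have u1 : u <= 1.
  by apply: (@le_trans _ _ (u * S)); [rewrite ler_peMr|lra].
have := powR_taylor2 p1 (introT andP (conj u0 u1)).
set rho := (1 + u) `^ p - 1 - p * u => rhoK.
have qE : t `^ p - T `^ p = P * T * (p * u + rho).
  rewrite {1}tu powRM ?(ltW T0)//; last by rewrite addr_ge0.
  by rewrite (powR_sub1M p T0) -/P /rho; ring.
rewrite -KE in rhoK.
(* The Taylor remainder is quadratic: [T * |rho| <= K * (u * S) ^+ 2]. This is why increments of
   order [T ^ (1 / 2)] are allowed. *)
have rhoT : T * `|rho| <= 1 / 10000.
  apply: (@le_trans _ _ (K * (u * S) * (u * S))).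
    rewrite [leRHS](_ : _ = T * (K * u ^+ 2)); last by rewrite -SS; ring.
    by rewrite ler_wpM2l// ltW.
  rewrite [leRHS](_ : _ = 1 / 100 * (1 / 100)); last by field.
  by apply: ler_pM => //; rewrite mulr_ge0// ltW.
split.
  (* The slope is chosen so that the linear term [p * u] cancels [t - T = T * u]; only the remainder
     is left. *)
  rewrite qE (_ : t - T + _ = - (T * rho / p)); last first.
    by rewrite [in LHS]tu; field; rewrite !gt_eqF.
  rewrite normrN !normrM (ger0_norm (ltW T0)) (@ger0_norm _ p^-1); last first.
    by rewrite invr_ge0 ltW.
  apply: le_trans rhoT; rewrite ler_pdivrMr// ler_peMr//; last exact: ltW.
  by rewrite mulr_ge0// ltW.
rewrite qE normrM (@ger0_norm _ (P * T)); last by rewrite mulr_ge0// ltW.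
apply: (@le_trans _ _ (P * T * (2 * (K * u)))).
  rewrite ler_wpM2l//; first by rewrite mulr_ge0// ltW.
  apply: le_trans (ler_normD _ _) _.
  rewrite (@ger0_norm _ (p * u)); last by rewrite mulr_ge0// ltW.
  have : K * u ^+ 2 <= K * u by rewrite ler_pM2l// expr2 ler_piMr.
  have : p * u <= K * u by rewrite ler_wpM2r.
  by move: rhoK; clear; lra.
rewrite [leLHS](_ : _ = P * S * (2 * (K * (u * S)))); last by rewrite -SS; ring.
rewrite ler_wpM2l//; first by rewrite mulr_ge0// ltW.
by move: uS; clear; lra.
Qed.

Lemma inv_le_half (R : realFieldType) (x y : R) : 1 <= x -> x / 2 <= y ->
  x^-1 <= 2 * (y / x ^+ 2).
Proof.
move=> x1 xy; have x0 : 0 < x by lra.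
have -> : x^-1 = x / x ^+ 2 by field; rewrite gt_eqF.
by rewrite mulrA ler_wpM2r ?invr_ge0 ?sqr_ge0//; lra.
Qed.

(** * Necessary conditions on [gamma] *)

Section exponents.
Context {R : realType}.
Variables (p alpha gamma : R).
Hypothesis p1 : 1 < p.
Hypothesis alpha02 : 0 < alpha < 2.
Hypothesis restriction : forall A d : R, 0 < A -> 0 <= d ->
  exists C : R, forall mu : {measure set (R * R) -> \bar R},
    compact (msupport mu) -> ediam (msupport mu) = d ->
    (forall (y : R * R) (r : R), 0 < r ->
      (mu (eball y r) <= (A * r `^ alpha)%:E)%E) ->
    (\int[lebesgue_measure]_(t in `]0%R, +oo[)
      (cmod (fourier mu (t, t `^ p)) ^+ 2 * t `^ gamma)%:E <= C%:E)%E.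

(** A single strip, the unit square, with base point 0: for small [t] the phase is almost constant,
    so the integral of [t ^ gamma] near 0 must stay bounded. *)
Lemma exponent_gtN1 : -1 < gamma.
Proof.
have /andP[alpha0 alpha2] := alpha02.
have p0 : p != 0 by rewrite gt_eqF// (lt_trans ltr01 p1).
rewrite ltNge; apply/negP => g1.
have [C C_bound] := energy_bound alpha02 restriction (ltr0Sn R 15).
have C0 := ler_norm C; have C1 := normr_ge0 C.
(* For [t <= 1 / 64] the phase error is at most [8 * (t + t ^ p) <= 16 / 64 = 1 / 4]. *)
pose s : R := 64^-1.
have s0 : 0 < s by rewrite /s; lra.
have s1 : s <= 1 by rewrite /s; lra.
have Ce : 0 < expR (- (`|C| + 1)) := expR_gt0 _.
have Ce1 : expR (- (`|C| + 1)) < 1 by rewrite -[ltRHS]expR0 ltr_expR; lra.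
(* Chosen so that [ln s - ln s' = |C| + 1], which exceeds [C]. *)
set s' := s * expR (- (`|C| + 1)).
have s'0 : 0 < s' by rewrite mulr_gt0.
have s's : s' < s by rewrite /s'; nra.
have : ((1%:R * (1 ^+ 2 * (1 * 1) ^+ 2))%:E *
    \int[lebesgue_measure]_(t in `[s', s]) (t `^ gamma)%:E <= C%:E)%E.
  apply: (C_bound 1%N 1 1 0 1 0 s' s) => //.
  - by rewrite ler01 lexx.
  - by rewrite normr0.
  - move=> r /andP[r0 r1]; rewrite mul1r mulr1.
    have rr : r ^+ 2 <= r `^ alpha.
      rewrite -powR_mulrn ?(ltW r0)//; apply: ger_powR; rewrite ?r0//.
      exact: ltW.
    apply: (@le_trans _ _ (2 * r * ((2 * r + 2) * (2 * r)))); last by nra.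
    by apply: minM_le; rewrite ?ge_min ?le_min ?lexx ?orbT//; lra.
  - move=> t j /andP[st ts]; rewrite ltnS leqn0 => /eqP ->.
    exists (- (2 * pi * (t `^ p - 0 `^ p) * (0%:R / 1%:R))) => x Px.
    apply: le_trans (phase_strip _ _ _ ler01 ler01 Px) _ => //.
    rewrite (powR0 p0).
    rewrite !subr0 mul0r addr0 !mulr1 !ger0_norm ?powR_ge0//; last lra.
    have : t `^ p <= s by apply: powR_le_self => //; [lra|rewrite s0].
    by rewrite /s in ts *; lra.
rewrite (_ : 1%:R * (1 ^+ 2 * (1 * 1) ^+ 2) = 1 :> R); last by ring.
rewrite mul1e => /(le_trans (integral_inv_ge g1 _ s1)).
rewrite s'0 s's => /(_ isT); rewrite lee_fin /s' lnM ?posrE// expRK.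
by lra.
Qed.

(** The comb has dimension [beta]; as [r ^ beta <= r ^ alpha] for [r <= 1], it is admissible for
    every [alpha <= beta]. *)
Lemma exponent_le_thin beta : alpha <= beta -> 1 <= beta < 2 ->
  gamma <= beta * p - beta / 2 - p.
Proof.
move=> ab b12; have /andP[b1 b2] := b12; have pp1 := p1.
have [C C_bound] := energy_bound alpha02 restriction (ltr0Sn R 15).
rewrite -subr_le0.
pose K : R := p ^+ 2 * expR p.
pose sg : R := (100 * K)^-1.
have K0 : 0 < K by rewrite mulr_gt0 ?expR_gt0// exprn_gt0// (lt_trans ltr01).
have K1 : 1 <= K.
  rewrite mulr_ege1 ?exprn_ege1 ?(ltW p1)// -[leLHS]expR0 ler_expR.
  by rewrite (le_trans ler01)// ltW.
have sg0 : 0 < sg by rewrite invr_gt0 mulr_gt0.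
have sg1 : sg <= 1.
  have K100 : 0 < 100 * K by rewrite mulr_gt0.
  by rewrite /sg invf_le1// mulr_ege1// ler1n.
pose m0 : R := Num.min 1 (2 `^ gamma).
have m00 : 0 < m0 by rewrite lt_min ltr01 powR_gt0.
apply: (@powR_bounded_le0 _ _ (2 * C / (m0 * sg))) => T T1.
have T0 : 0 < T := lt_le_trans ltr01 T1.
have pT x : 0 < T `^ x by apply: powR_gt0.
pose S := T `^ (1 / 2); pose L := T `^ (p - 1 / 2).
have S1 : 1 <= S by apply: powR_ge1; lra.
have L1 : 1 <= L by apply: powR_ge1; lra.
have L0 : 0 < L := lt_le_trans ltr01 L1.
pose X := L `^ (beta - 1).
have X1 : 1 <= X by apply: powR_ge1; lra.
have X0 : 0 < X := lt_le_trans ltr01 X1.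
have XL : X <= L.
  by rewrite -[leRHS](powRr1 (ltW L0)); apply: ler_powR; lra.
have [n [n0 nX Xn]] := natr_truncn_half X1.
have Li0 : 0 < L^-1 by rewrite invr_gt0.
(* The direction [(1, a)] is orthogonal to the tangent direction [(1, p * T ^ (p - 1))]. *)
pose a := - (p * T `^ (p - 1))^-1.
have a1 : `|a| <= 1.
  have pP1 : 1 <= p * T `^ (p - 1).
    by rewrite mulr_ege1 ?(ltW p1)// powR_ge1// subr_ge0 ltW.
  have pP0 := lt_le_trans ltr01 pP1.
  by rewrite /a normrN ger0_norm ?invr_ge0 ?invf_le1// ltW.
have sgS : 0 <= sg * S <= T.
  rewrite mulr_ge0 ?(ltW sg0) ?(le_trans ler01)//= -(powR_half_sqr T0).
  by rewrite ler_wpM2r ?(le_trans ler01)// (le_trans sg1).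
have main : ((n%:R * ((L / X) ^+ 2 * (1 * L^-1) ^+ 2))%:E *
    \int[lebesgue_measure]_(t in `[T, (T + sg * S)%R]) (t `^ gamma)%:E <= C%:E)%E.
  apply: (C_bound n 1 L^-1 a (L / X) T) => //.
  - by rewrite ler01 lexx.
  - exact: ltW.
  - by rewrite ler_pdivrMr// mul1r (le_trans nX).
  - by rewrite divr_ge0// ltW.
  - move=> r r01; apply: le_trans (thin_comb_ball b12 L1 nX r01) _.
    by rewrite ler_wpM2l//; apply: ger_powR.
  - move=> t j /andP[Tt ts] jn.
    exists (- (2 * pi * (t `^ p - T `^ p) * (j%:R / n%:R))) => x Px.
    apply: le_trans (phase_strip _ _ _ ler01 (ltW Li0) Px) _ => //.
    have [|h1 h2] := @tangent_estimates _ p T t K p1 T1 erefl.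
      by rewrite subr_ge0 Tt lerBlDl.
    (* The phase error is at most [8 * (1 / 10000 + 1 / 50)], below [1 / 4]. *)
    rewrite mulr1; move: h1 h2; rewrite -/a -/L => h1.
    rewrite mulrC -ler_pdivrMr// [_ / L]mulrC mulrC => h2.
    by move: h1 h2; clear; lra.
have lower : ((T `^ gamma * m0 * (sg * S))%:E <=
    \int[lebesgue_measure]_(t in `[T, (T + sg * S)%R]) (t `^ gamma)%:E)%E.
  rewrite [X in (_ * X)%:E](_ : _ = T + sg * S - T); last by rewrite addrC addKr.
  apply: integral_powR_ge; first by rewrite lerDl; case/andP: sgS.
    by rewrite mulr_ge0 ?ltW.
  move=> t ts; apply: powR_ge_dyadic => //.
  by move: ts sgS; clear; lra.
have co0 : 0 <= n%:R * ((L / X) ^+ 2 * (1 * L^-1) ^+ 2).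
  by apply: mulr_ge0 => //; apply: mulr_ge0; exact: sqr_ge0.
have := le_trans (lee_wpmul2l _ lower) main.
rewrite lee_fin => /(_ co0); rewrite -EFinM lee_fin => {main lower} main.
have coE : n%:R * ((L / X) ^+ 2 * (1 * L^-1) ^+ 2) = n%:R / X ^+ 2.
  by field; rewrite !gt_eqF.
(* Exponent balance: the range of [t] has length of order [T ^ (1 / 2)], and the comb contributes
   [n / X ^+ 2], of order [1 / X] with [X = T ^ ((p - 1 / 2) * (beta - 1))]. *)
have -> : T `^ (gamma - (beta * p - beta / 2 - p)) = T `^ gamma * S / X.
  rewrite /X /L -powRrM -powRN -!powRD; last 2 first.
  - by apply/implyP => _; rewrite gt_eqF.
  - by apply/implyP => _; rewrite gt_eqF.
  by congr (_ `^ _); field.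
rewrite ler_pdivlMr ?mulr_gt0//; apply: le_trans (_ : 2 * (n%:R / X ^+ 2 *
    (T `^ gamma * m0 * (sg * S))) <= _); last by rewrite ler_pM2l// -coE.
rewrite (_ : _ / X * _ = X^-1 * (T `^ gamma * m0 * (sg * S))); last by ring.
rewrite [leRHS]mulrA ler_wpM2r//; last exact: inv_le_half.
by apply: mulr_ge0; apply: mulr_ge0; rewrite ?(ltW (pT _)) ?(ltW m00) ?(ltW sg0).
Qed.

(** Rectangles dual to the whole arc up to [T] allow the base point 0 and a range of [t] of length
    proportional to [T]. *)
Lemma exponent_le_point : alpha <= 1 -> gamma <= alpha - 1.
Proof.
move=> a1; have /andP[alpha0 alpha2] := alpha02; have pK1 := p1.
have [C C_bound] := energy_bound alpha02 restriction (ltr0Sn R 15).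
have p0 : p != 0 by rewrite gt_eqF// (lt_trans ltr01 p1).
rewrite -subr_le0.
(* For [t <= 2 * sg * T] both [t / T] and [t ^ p / Q] are at most [1 / 64], so the phase error is at
   most [1 / 4]. *)
pose sg : R := 128^-1.
have sg0 : 0 < sg by rewrite /sg; lra.
pose m0 : R := sg `^ gamma * Num.min 1 (2 `^ gamma).
have m00 : 0 < m0 by rewrite mulr_gt0 ?lt_min ?ltr01 ?powR_gt0.
have mg0 : 0 < m0 * sg by rewrite mulr_gt0.
apply: (@powR_bounded_le0 _ _ (2 * C / (m0 * sg))) => T T1.
have T0 : 0 < T by lra.
pose Q := T `^ p; pose X := T `^ alpha.
have TQ : T <= Q.
  by rewrite -[leLHS](powRr1 (ltW T0)); apply: ler_powR => //; lra.
have X1 : 1 <= X by apply: powR_ge1 => //; lra.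
have XT : X <= T.
  by rewrite -[leRHS](powRr1 (ltW T0)); apply: ler_powR => //; lra.
have Q0 : 0 < Q by lra.
have [n [n0 nX Xn]] := natr_truncn_half X1.
have Ti0 : 0 < T^-1 by rewrite invr_gt0.
have Qi0 : 0 < Q^-1 by rewrite invr_gt0.
have sT0 : 0 < sg * T by rewrite mulr_gt0.
have main : ((n%:R * ((T * Q / X) ^+ 2 * (T^-1 * Q^-1) ^+ 2))%:E *
    \int[lebesgue_measure]_(t in `[(sg * T)%R, (2 * (sg * T))%R])
      (t `^ gamma)%:E <= C%:E)%E.
  apply: (C_bound n T^-1 Q^-1 0 (T * Q / X) 0) => //.
  - by rewrite ltW//= invf_le1.
  - exact: ltW.
  - by rewrite ler_pdivrMr// mul1r (le_trans nX)// (le_trans XT).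
  - by rewrite normr0.
  - by rewrite divr_ge0//; [rewrite mulr_ge0// ltW|lra].
  - move=> r r01; apply: point_comb_ball => //.
    by rewrite alpha0.
  - move=> t j /andP[st ts] jn.
    exists (- (2 * pi * (t `^ p - 0 `^ p) * (j%:R / n%:R))) => x Px.
    apply: le_trans (phase_strip _ _ _ (ltW Ti0) (ltW Qi0) Px) _ => //.
    rewrite (powR0 p0) !subr0 mul0r addr0 (ger0_norm (powR_ge0 _ _)).
    have t0 : 0 <= t by lra.
    rewrite (ger0_norm t0).
    have tT : t / T <= 1 / 64 by rewrite ler_pdivrMr//; move: ts; rewrite /sg; lra.
    have : t `^ p / Q <= 1 / 64.
      rewrite /Q -(divfK (lt0r_neq0 T0) t) powRM ?divr_ge0 ?(ltW T0)//.
      rewrite mulfK; last by rewrite gt_eqF.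
      by apply: powR_le_self => //; [rewrite divr_ge0// ltW|lra].
    by lra.
have lower : ((T `^ gamma * m0 * (sg * T))%:E <=
    \int[lebesgue_measure]_(t in `[(sg * T)%R, (2 * (sg * T))%R])
      (t `^ gamma)%:E)%E.
  rewrite [X in (_ * X)%:E](_ : _ = 2 * (sg * T) - sg * T); last by ring.
  apply: integral_powR_ge; [lra|by rewrite mulr_ge0 ?powR_ge0 ?ltW|move=> t ts].
  rewrite /m0 mulrA -powRM ?(ltW T0) ?(ltW sg0)// (mulrC T).
  by apply: powR_ge_dyadic => //; lra.
have co0 : 0 <= n%:R * ((T * Q / X) ^+ 2 * (T^-1 * Q^-1) ^+ 2).
  by apply: mulr_ge0 => //; apply: mulr_ge0; exact: sqr_ge0.
have := le_trans (lee_wpmul2l _ lower) main.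
rewrite lee_fin => /(_ co0); rewrite -EFinM lee_fin => {main lower} main.
have coE : n%:R * ((T * Q / X) ^+ 2 * (T^-1 * Q^-1) ^+ 2) = n%:R / X ^+ 2.
  by field; rewrite !gt_eqF//; lra.
(* Here the range of [t] contributes [T] and the comb about [1 / X] with [X = T ^ alpha]. *)
have -> : T `^ (gamma - (alpha - 1)) = T `^ gamma * T / X.
  rewrite /X -[X in _ * X / _](powRr1 (ltW T0)) -powRN -!powRD; last 2 first.
  - by apply/implyP => _; rewrite gt_eqF.
  - by apply/implyP => _; rewrite gt_eqF.
  by congr (_ `^ _); ring.
rewrite ler_pdivlMr//; apply: le_trans (_ : 2 * (n%:R / X ^+ 2 *
    (T `^ gamma * m0 * (sg * T))) <= _); last by rewrite ler_pM2l// -coE.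
rewrite (_ : _ / X * _ = X^-1 * (T `^ gamma * m0 * (sg * T))); last by ring.
rewrite [leRHS]mulrA ler_wpM2r//; last exact: inv_le_half.
by apply: mulr_ge0; [rewrite mulr_ge0 ?powR_ge0// ltW|exact: ltW].
Qed.

End exponents.

Theorem theorem1p3 (R : realType) (p alpha gamma : R)
  (hp : 1 < p) (halpha : 0 < alpha < 2)
  (hC : forall A d : R, 0 < A -> 0 <= d ->
     exists C : R, forall mu : {measure set (R * R) -> \bar R},
       compact (msupport mu) ->
       ediam (msupport mu) = d ->
       (forall (y : R * R) (r : R), 0 < r ->
          (mu (eball y r) <= (A * r `^ alpha)%:E)%E) ->
       (\int[lebesgue_measure]_(t in `]0%R, +oo[)
          (cmod (fourier mu (t, t `^ p)) ^+ 2 * t `^ gamma)%:E <= C%:E)%E) :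
  [/\ 1 < alpha < 2 -> -1 < gamma <= alpha * p - alpha / 2 - p,
      1 / 2 < alpha <= 1 -> -1 < gamma <= - (1 / 2) &
      0 < alpha <= 1 / 2 -> -1 < gamma <= alpha - 1].
Proof.
have g1 := exponent_gtN1 hp halpha hC.
split=> /andP[a1 a2]; rewrite g1 /=.
- by apply: (exponent_le_thin hp halpha hC) => //; rewrite ltW.
(* With [beta = 1] the bound [beta * p - beta / 2 - p] becomes [- 1 / 2]. *)
- have := exponent_le_thin hp halpha hC a2.
  by rewrite lexx ltr1n => /(_ isT); lra.
- by apply: (exponent_le_point hp halpha hC); lra.
Qed.
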